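(* Let $\mathcal N$ be an $L$-finite structure, let $\{\mathcal M_\alpha\}_{\alpha\le\lambda(\mathcal N)}$ be a Tarski hierarchy over $\mathcal N$ and let $\{\mathcal M^p_\alpha\}_{\alpha\le\lambda^p(\mathcal N)}$ be a proper Tarski hierarchy over $\mathcal N$. Then $\lambda^p(\mathcal N)>\lambda(\mathcal N)$, and for every $\alpha\le\lambda(\mathcal N)$, $\mathcal M^p_\alpha\sim\mathcal M_\alpha$. Hence the structure $\mathcal M_{\lambda(\mathcal N)}$ does not have a canonic universal predicate but does have a canonic proper universal predicate.
   Context: Structures. An $n$-ary predicate ($n>0$) is a pair $\langle A,n\rangle$ with $A\subseteq\omega^n$; an $n$-ary function symbol ($n\ge 0$) is a pair $\langle f,n\rangle$ with $f:\omega^n\to\omega$ total. Symbols are thus inherently interpreted over $\omega$. Let $\mathbf A=\{=,<,S,+,\cdot\}$ with the usual interpretation. A structure is a set $\mathcal M$ of predicates and function symbols with $\mathbf A\subseteq\mathcal M$; it is $L$-finite iff it is a finite set. $\mathcal M+Y$ denotes $\mathcal M\cup Y$ (relations are identified with the corresponding predicates). A set $X\subseteq\omega^k$ is definable in $\mathcal M$ iff it is the extension of a first-order formula (variables ranging over $\omega$) with symbols from $\mathcal M$. $\mathcal D(\mathcal M)$ is the set of all $X\subseteq\omega$ definable in $\mathcal M$, and $\mathcal M\sim\mathcal N$ means $\mathcal D(\mathcal M)=\mathcal D(\mathcal N)$. Universal predicates. For $G\subseteq\omega^2$ let $G(n,.)=\{m\in\omega: G(n,m)\}$. $G$ is a universal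 predicate for $\mathcal M$ iff $\mathcal D(\mathcal M)\subseteq\{G(n,.):n\in\omega\}$, and a proper universal predicate for $\mathcal M$ iff $\mathcal D(\mathcal M)=\{G(n,.):n\in\omega\}$. $P_0$ is a canonic universal predicate (resp. canonic proper universal predicate) for $\mathcal M$ iff $P_0$ is a universal (resp. proper universal) predicate for $\mathcal M$ and, for every universal (resp. proper universal) predicate $P$ for $\mathcal M$, $P_0$ is definable in $\mathcal M+P$. Hierarchies. A Tarski hierarchy over a countable structure $\mathcal N$ is a sequence of structures $\{\mathcal M_\alpha\}_{\alpha\le\lambda(\mathcal N)}$ such that (1) $\mathcal M_0=\mathcal N$; (2) for every $\alpha<\lambda(\mathcal N)$, $\mathcal M_\alpha$ has a canonic universal predicate and $\mathcal M_{\alpha+1}=\mathcal M_\alpha\cup\{P_\alpha\}$, where $P_\alpha$ is a canonic universal predicate for $\mathcal M_\alpha$; (3) $\mathcal M_\beta=\bigcup_{\gamma<\beta}\mathcal M_\gamma$ for every limit ordinal $\beta\le\lambda(\mathcal N)$; (4) $\lambda(\mathcal N)$ is the maximum ordinal satisfying (1)–(3), i.e. the sequence cannot be continued because $\mathcal M_{\lambda(\mathcal N)}$ has no canonic universal predicate. A proper Tarski hierarchy $\{\mathcal M^p_\alpha\}_{\alpha\le\lambda^p(\mathcal N)}$ is defined in the same way with ''canonic universal predicate'' replaced by ''canonic proper universal predicate'' and $\lambda(\mathcal N)$ by $\lambda^p(\mathcal N)$. *)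

(* Defs.v *)
From mathcomp Require Import all_boot all_order.
From mathcomp Require Import boolp classical_sets cardinality wochoice.

Set Implicit Arguments.
Unset Strict Implicit.
Unset Printing Implicit Defensive.

Local Open Scope classical_set_scope.

(* Points of omega^k are functions 'I_k -> nat.  A symbol carries its own
   interpretation over omega; predicates have positive arity n.+1, and
   functions may be 0-ary. *)
Inductive symbol : Type :=
| PredSym (n : nat) (A : set ('I_n.+1 -> nat))
| FunSym (n : nat) (f : ('I_n -> nat) -> nat).

(* A binary relation is given by its sections: G n = G(n,.) *)
Definition rel_set (G : nat -> set nat) : set ('I_2 -> nat) :=
  [set v | G (v ord0) (v ord_max)].

Definition rel_symbol (G : nat -> set nat) : symbol := PredSym (rel_set G).

Definition fun1_symbol (f : nat -> nat) : symbol :=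
  FunSym (fun v : 'I_1 -> nat => f (v ord0)).

Definition fun2_symbol (f : nat -> nat -> nat) : symbol :=
  FunSym (fun v : 'I_2 -> nat => f (v ord0) (v ord_max)).

Definition arith : set symbol :=
  [set rel_symbol (fun x y : nat => x = y);
       rel_symbol (fun x y : nat => (x < y)%N);
       fun1_symbol S; fun2_symbol addn; fun2_symbol muln].

Definition is_structure (M : set symbol) : Prop := arith `<=` M.

Definition L_finite (M : set symbol) : Prop := finite_set M.

(* Terms and formulas whose free variables are among k variables.  The
   quantifier binds variable ord0 of its body.  Equality is not primitive: it
   is a symbol of arith. *)
Inductive term (k : nat) : Type :=
| Var (i : 'I_k)
| App (n : nat) (f : ('I_n -> nat) -> nat) (args : 'I_n -> term k).

Inductive formula : nat -> Type :=
| Atom (k n : nat) (A : set ('I_n.+1 -> nat)) (args : 'I_n.+1 -> term k) :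
    formula k
| Neg (k : nat) (phi : formula k) : formula k
| And (k : nat) (phi psi : formula k) : formula k
| Or (k : nat) (phi psi : formula k) : formula k
| Imp (k : nat) (phi psi : formula k) : formula k
| Exists (k : nat) (phi : formula k.+1) : formula k
| Forall (k : nat) (phi : formula k.+1) : formula k.

Fixpoint eval (k : nat) (v : 'I_k -> nat) (t : term k) : nat :=
  match t with
  | Var i => v i
  | App _ f args => f (fun i => eval v (args i))
  end.

Definition vcons (k : nat) (m : nat) (v : 'I_k -> nat) : 'I_k.+1 -> nat :=
  fun i => oapp v m (unlift ord0 i).

Fixpoint sat (k : nat) (phi : formula k) : ('I_k -> nat) -> Prop :=
  match phi with
  | Atom _ _ A args => fun v => A (fun i => eval v (args i))
  | Neg _ phi => fun v => ~ sat phi v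
  | And _ phi psi => fun v => sat phi v /\ sat psi v
  | Or _ phi psi => fun v => sat phi v \/ sat psi v
  | Imp _ phi psi => fun v => sat phi v -> sat psi v
  | Exists _ phi => fun v => exists m, sat phi (vcons m v)
  | Forall _ phi => fun v => forall m, sat phi (vcons m v)
  end.

Fixpoint term_over (M : set symbol) (k : nat) (t : term k) : Prop :=
  match t with
  | Var _ => True
  | App _ f args => M (FunSym f) /\ forall i, term_over M (args i)
  end.

Fixpoint formula_over (M : set symbol) (k : nat) (phi : formula k) : Prop :=
  match phi with
  | Atom _ _ A args => M (PredSym A) /\ forall i, term_over M (args i)
  | Neg _ phi => formula_over M phi
  | And _ phi psi => formula_over M phi /\ formula_over M psi
  | Or _ phi psi => formula_over M phi /\ formula_over M psi
  | Imp _ phi psi => formula_over M phi /\ formula_over M psi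
  | Exists _ phi => formula_over M phi
  | Forall _ phi => formula_over M phi
  end.

Definition definable (M : set symbol) (k : nat) (X : set ('I_k -> nat)) : Prop :=
  exists phi : formula k, formula_over M phi /\ X = sat phi.

Definition Def (M : set symbol) : set (set nat) :=
  [set X : set nat | definable M [set v : 'I_1 -> nat | X (v ord0)]].

Definition same_Def (M N : set symbol) : Prop := Def M = Def N.

Definition expand (M : set symbol) (G : nat -> set nat) : set symbol :=
  M `|` [set rel_symbol G].

Definition universal (M : set symbol) (G : nat -> set nat) : Prop :=
  Def M `<=` range G.

Definition proper_universal (M : set symbol) (G : nat -> set nat) : Prop :=
  Def M = range G.

Definition canonic_universal (M : set symbol) (P0 : nat -> set nat) : Prop :=
  universal M P0 /\
  forall P, universal M P -> definable (expand M P) (rel_set P0).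

Definition canonic_proper_universal (M : set symbol) (P0 : nat -> set nat) :
    Prop :=
  proper_universal M P0 /\
  forall P, proper_universal M P -> definable (expand M P) (rel_set P0).

(* Ordinals are the elements of a well-ordered type O.  Any two ordinals are
   elements of a common such O, which is universally quantified wherever
   hierarchies are considered. *)
Section Hierarchy.
Context {d : Order.disp_t} {O : orderType d}.
Local Open Scope order_scope.

Definition is_zero (a : O) : Prop := forall b : O, a <= b.

Definition is_succ (a b : O) : Prop := a < b /\ forall c : O, a < c -> b <= c.

Definition is_limit (b : O) : Prop :=
  ~ is_zero b /\ ~ exists a : O, is_succ a b.

(* canonic M P is "P is a canonic (proper) universal predicate for M".  Only
   the values M a with a <= lam matter. *)
Record hierarchy (canonic : set symbol -> (nat -> set nat) -> Prop)
    (N : set symbol) (lam : O) (M : O -> set symbol) : Prop := Hierarchy {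
  hierarchy_structure : is_structure N;
  hierarchy_countable : countable N;
  hierarchy_zero : forall a : O, is_zero a -> M a = N;
  hierarchy_succ : forall a b : O, a < lam -> is_succ a b ->
    exists2 P, canonic (M a) P & M b = expand (M a) P;
  hierarchy_limit : forall b : O, b <= lam -> is_limit b ->
    M b = \bigcup_(c in [set c : O | c < b]) M c;
  hierarchy_max : ~ exists P, canonic (M lam) P
}.

Definition tarski_hierarchy := hierarchy canonic_universal.

Definition proper_tarski_hierarchy := hierarchy canonic_proper_universal.

End Hierarchy.

(* Main.v *)
Require Import Defs.
From mathcomp Require Import all_boot all_order.
From mathcomp Require Import boolp classical_sets cardinality wochoice.
From mathcomp Require Import zify.
From Stdlib Require Cantor.

Set Implicit Arguments.
Unset Strict Implicit.
Unset Printing Implicit Defensive.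

Import Order.TTheory.
Local Open Scope classical_set_scope.

(** Both hierarchies are compared with a third one that can be enumerated: the
iteration of truth predicates along a single ill-founded order.

Let [A] code the finitely many symbols of [N]. For a relation [V] let [Tr A V] be
the truth predicate of [N] with [V]; its columns are the sets definable there
([Def_col_Tr], [Def_Tr_col]). It is characterized by first-order clauses, and its
restriction to the first [n] formulas is definable, so it is definable from every
universal predicate of a structure in which [V] is definable ([truth_viaE]).

A hierarchy along a transitive relation [R] assigns to each point [c] the truth
predicate for the part of the hierarchy below [c]. On the accessible part of [R]
there is just one such hierarchy, [true_hier]. The order used here is that of a
tree of finite attempts to build, along the order of the tree itself, a hierarchy
in which no set enumerated at any level reveals a descending sequence. This tree
exists because finite attempts only depend on smaller nodes. Were the tree
well-founded, the true hierarchy would be a branch of it; so it is ill-founded,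
and a branch is a pseudo-hierarchy below its root 0 ([pseudo_hierarchy]).

Write [V b] for the part of the true hierarchy below an accessible [b].

- The level of any hierarchy at an inaccessible point enumerates all sets
  definable in any [M a]: by induction on [a], lower inaccessible levels are
  universal predicates for the earlier structures, and canonicity makes the
  canonic universal predicates definable from them ([nonacc_above]). By the
  diagonal argument a hierarchy below an inaccessible point is never definable in
  [M a] ([hier_acc]).
- If [V b] is not definable in [M a], then the levels below [b] form a universal
  predicate for [M a] ([universal_below]).
- If [M a] has a canonic universal predicate [P], then [V b] is not definable in
  [M a] for some accessible [b] ([undefinable_below]). Otherwise consider the points of the
  pseudo-hierarchy that enumerate [P]; all inaccessible ones do. A minimal point
  among them is accessible, and [P] becomes definable in [M a].

The first [b] with [V b] not definable in [M a] gives a proper universal predicate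
definable from [P] ([canonic_gives_proper]). Hence canonic and canonic proper
universal predicates of [M a] are definable from each other over [M a], and the two
hierarchies agree as long as both go on. On the other hand, for every
[a <= lam] the levels at those [b] with [V b] definable in [M a] form a canonic
proper universal predicate ([enumeration_canonic]): a proper universal predicate
contains hierarchies below accessible points only, hence it finds exactly these
levels. So the proper hierarchy does not stop at or before [lam]. *)
(** * Environments *)
Notation env := (nat -> nat).

Definition scons (m : nat) (v : env) : env :=
  fun i => if i is j.+1 then v j else m.

Definition sapp (n : nat) (l v : env) : env :=
  fun i => if i < n then l i else v (i - n).

Lemma vcons_scons k m (v : env) :
  vcons m (fun i : 'I_k => v i) = (fun i : 'I_k.+1 => scons m v i).
Proof.
by apply: funext => i; rewrite /vcons; case: unliftP => [j ->|->].
Qed.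

(** * Renaming the variables of a formula *)

Definition lift_ren k l (r : 'I_k -> 'I_l) : 'I_k.+1 -> 'I_l.+1 :=
  fun i => oapp (fun j => lift ord0 (r j)) ord0 (unlift ord0 i).

Fixpoint tren k l (r : 'I_k -> 'I_l) (t : term k) : term l :=
  match t with
  | Var i => Var (r i)
  | App _ f args => App f (fun i => tren r (args i))
  end.

Fixpoint fren k (phi : formula k) : forall l, ('I_k -> 'I_l) -> formula l :=
  match phi in formula k return forall l, ('I_k -> 'I_l) -> formula l with
  | Atom _ _ A args => fun l r => Atom A (fun i => tren r (args i))
  | Neg _ phi => fun l r => Neg (fren phi r)
  | And _ phi psi => fun l r => And (fren phi r) (fren psi r)
  | Or _ phi psi => fun l r => Or (fren phi r) (fren psi r)
  | Imp _ phi psi => fun l r => Imp (fren phi r) (fren psi r)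
  | Exists _ phi => fun l r => Exists (fren phi (lift_ren r))
  | Forall _ phi => fun l r => Forall (fren phi (lift_ren r))
  end.

Lemma eval_tren k l (r : 'I_k -> 'I_l) (t : term k) v :
  eval v (tren r t) = eval (fun i => v (r i)) t.
Proof.
elim: t => [//|n f args IH] /=.
by congr f; apply: funext => i; exact: IH.
Qed.

Lemma vcons_lift_ren k l (r : 'I_k -> 'I_l) m v :
  (fun i => vcons m v (lift_ren r i)) = vcons m (fun i => v (r i)).
Proof.
apply: funext => i; rewrite /vcons /lift_ren.
case: (unliftP ord0 i) => [j _|_] /=; last by rewrite unlift_none.
by rewrite liftK.
Qed.

Lemma sat_fren k (phi : formula k) : forall l (r : 'I_k -> 'I_l) v,
  sat (fren phi r) v <-> sat phi (fun i => v (r i)).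
Proof.
elim: phi => {k} /=.
- move=> k n A args l r v.
  suff -> : (fun i => eval v (tren r (args i))) =
            (fun i => eval (fun i0 => v (r i0)) (args i)) by [].
  by apply: funext => i; rewrite eval_tren.
- by move=> k phi IH l r v; rewrite IH.
- by move=> k phi IH psi IH' l r v; rewrite IH IH'.
- by move=> k phi IH psi IH' l r v; rewrite IH IH'.
- by move=> k phi IH psi IH' l r v; rewrite IH IH'.
- move=> k phi IH l r v.
  by split=> -[m h]; exists m; move: h; rewrite IH vcons_lift_ren.
- move=> k phi IH l r v.
  by split=> h m; move: (h m); rewrite IH vcons_lift_ren.
Qed.

Lemma term_over_tren (M : set symbol) k l (r : 'I_k -> 'I_l) (t : term k) :
  term_over M t -> term_over M (tren r t).
Proof. by elim: t => [//|n f args IH] /= [Mf h]; split => // i; exact: IH. Qed.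

Lemma formula_over_fren (M : set symbol) k (phi : formula k) :
  forall l (r : 'I_k -> 'I_l), formula_over M phi -> formula_over M (fren phi r).
Proof.
elim: phi => {k} /=; try by move=> *; intuition.
by move=> k n A args l r [MA h]; split => // i; exact: term_over_tren.
Qed.

(** * Definable conditions on environments *)

(** Conditions on infinite environments avoid the bookkeeping of the number of
free variables: a formula reads only finitely many places. *)
Definition edef (M : set symbol) (F : env -> Prop) : Prop :=
  exists k (phi : formula k),
    formula_over M phi /\ forall v, F v <-> sat phi (fun i => v i).

Definition sym_ext (s : symbol) : env -> Prop :=
  match s with
  | PredSym _ A => fun v => A (fun i => v i)
  | FunSym _ f => fun v => v 0 = f (fun i => v i.+1)
  end.

Record fo_closed (C : (env -> Prop) -> Prop) : Prop := FoClosed {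
  fo_ext : forall F G, (forall v, F v <-> G v) -> C F -> C G;
  fo_not : forall F, C F -> C (fun v => ~ F v);
  fo_and : forall F G, C F -> C G -> C (fun v => F v /\ G v);
  fo_ex : forall F, C F -> C (fun v => exists m, F (scons m v));
  fo_eq : forall i j, C (fun v => v i = v j)
}.

Section FoClosed.
Variables (C : (env -> Prop) -> Prop) (hC : fo_closed C).

Lemma fo_true : C (fun=> True).
Proof. by apply: fo_ext (fo_eq hC 0 0). Qed.

Lemma fo_or F G : C F -> C G -> C (fun v => F v \/ G v).
Proof.
move=> cF cG.
apply: fo_ext (fo_not hC (fo_and hC (fo_not hC cF) (fo_not hC cG))) => // v.
by split=> [|]; [move=> h; apply: contrapT => n; apply: h; tauto|tauto].
Qed.

Lemma fo_imp F G : C F -> C G -> C (fun v => F v -> G v).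
Proof.
move=> cF cG; apply: fo_ext (fo_or (fo_not hC cF) cG) => // v.
split; first tauto.
by have [?|?] := pselect (F v); tauto.
Qed.

Lemma fo_iff F G : C F -> C G -> C (fun v => F v <-> G v).
Proof. by move=> cF cG; apply: fo_and => //; exact: fo_imp. Qed.

Lemma fo_all F : C F -> C (fun v => forall m, F (scons m v)).
Proof.
move=> cF; apply: fo_ext (fo_not hC (fo_ex hC (fo_not hC cF))) => // v.
split=> [h m|h [m]]; last exact.
by apply: contrapT => n; apply: h; exists m.
Qed.

Lemma fo_ball (I : eqType) (s : seq I) (F : I -> env -> Prop) :
  (forall i, C (F i)) -> C (fun v => forall i, i \in s -> F i v).
Proof.
move=> cF; elim: s => [|i s IH]; first by apply: fo_ext fo_true.
apply: fo_ext (fo_and hC (cF i) IH) => // v; split.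
  by move=> [h1 h2] j; rewrite inE => /orP[/eqP->|/h2].
by move=> h; split=> [|j js]; apply: h; rewrite inE ?eqxx ?js ?orbT.
Qed.

Lemma fo_fin_all n (F : 'I_n -> env -> Prop) :
  (forall i, C (F i)) -> C (fun v => forall i, F i v).
Proof.
move=> cF; apply: fo_ext (fo_ball (enum 'I_n) cF) => // v.
by split=> h i => [|_]; apply: h; rewrite ?mem_enum.
Qed.

Lemma fo_exs n F : C F -> C (fun v => exists l, F (sapp n l v)).
Proof.
elim: n F => [|n IH] F cF.
  apply: fo_ext cF => // v.
  have e l : sapp 0 l v = v by apply: funext => i; rewrite /sapp subn0.
  by split=> [h|[l]]; [exists v|]; rewrite e.
apply: fo_ext (IH _ (fo_ex hC cF)) => // v.
have e m l : scons m (sapp n l v) = sapp n.+1 (scons m l) v.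
  by apply: funext => -[|i].
split=> [[l [m h]]|[l h]]; first by exists (scons m l); rewrite -e.
exists (fun i => l i.+1), (l 0); rewrite e.
by congr F: h; apply: funext => -[|i].
Qed.

Variables (M : set symbol).
Hypothesis C_sym : forall s, M s -> C (sym_ext s).

Lemma sapp_lt n l v i : i < n -> sapp n l v i = l i.
Proof. by rewrite /sapp => ->. Qed.

Lemma sapp_ge n l v i : sapp n l v (i + n) = v i.
Proof. by rewrite /sapp ltnNge leq_addl /= addnK. Qed.

Lemma fo_term k (t : term k) : term_over M t ->
  forall j s, C (fun v => v j = eval (fun i : 'I_k => v (i + s)) t).
Proof.
elim: t => [i _ j s|n f args IH] /=; first exact: fo_eq.
move=> [Mf h] j s.
have cF : C (fun w => w 0 = f (fun i => w i.+1) /\ (w 0 = w (j + n.+1) /\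
   forall i : 'I_n, w i.+1 =
     eval (fun i0 : 'I_k => w (i0 + (s + n.+1))) (args i))).
  apply: fo_and => //; first exact: (C_sym Mf).
  apply: fo_and => //; first exact: fo_eq.
  by apply: fo_fin_all => i; exact: IH.
apply: fo_ext (fo_exs n.+1 cF) => // v.
have e l : (fun i0 : 'I_k => sapp n.+1 l v (i0 + (s + n.+1))) =
    (fun i0 : 'I_k => v (i0 + s)).
  by apply: funext => i0; rewrite addnA sapp_ge.
split=> [[l]|h1].
  rewrite sapp_ge => -[e1 [<- e2]]; rewrite e1; congr f.
  by apply: funext => i; rewrite e2 e.
exists (scons (v j) (fun i => if insub i is Some i' then
    eval (fun i0 : 'I_k => v (i0 + s)) (args i') else 0)).
set l := scons _ _.
have el (i : 'I_n) : sapp n.+1 l v i.+1 =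
    eval (fun i0 : 'I_k => v (i0 + s)) (args i).
  rewrite sapp_lt ?ltnS //= insubT //= => lti.
  by congr (eval _ (args _)); apply: val_inj.
split; last by split=> [|i]; rewrite ?sapp_ge // e el.
by rewrite sapp_lt //= h1; congr f; apply: funext => i; rewrite el.
Qed.

(** The truth of a formula only uses the operations of [fo_closed]: nested
terms are unfolded by quantifying over the values of their subterms. *)
Lemma fo_formula k (phi : formula k) : formula_over M phi ->
  C (fun v => sat phi (fun i => v i)).
Proof.
elim: phi => {k} /=.
- move=> k n A args [MA h].
  have cF : C (fun w => A (fun i => w i) /\ forall i : 'I_n.+1, w i =
      eval (fun i0 : 'I_k => w (i0 + n.+1)) (args i)).
    apply: fo_and => //; first exact: (C_sym MA).
    by apply: fo_fin_all => i; exact: fo_term.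
  apply: fo_ext (fo_exs n.+1 cF) => // v.
  have e l : (fun i0 : 'I_k => sapp n.+1 l v (i0 + n.+1)) =
      (fun i0 : 'I_k => v i0) by apply: funext => i0; rewrite sapp_ge.
  split=> [[l [h1 h2]]|h1].
    by congr A: h1; apply: funext => i; rewrite h2 e.
  pose l : env := fun i => eval (fun i0 : 'I_k => v i0) (args (inord i)).
  exists l; have el (i : 'I_n.+1) : sapp n.+1 l v i =
      eval (fun i0 : 'I_k => v i0) (args i).
    by rewrite sapp_lt // /l inord_val.
  split=> [|i]; last by rewrite e el.
  by congr A: h1; apply: funext => i; rewrite el.
- by move=> k phi IH h; apply: fo_not => //; exact: IH.
- by move=> k phi IH psi IH' [h h']; apply: fo_and => //; [exact: IH|exact: IH'].
- by move=> k phi IH psi IH' [h h']; apply: fo_or; [exact: IH|exact: IH'].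
- by move=> k phi IH psi IH' [h h']; apply: fo_imp; [exact: IH|exact: IH'].
- move=> k phi IH h; apply: fo_ext (fo_ex hC (IH h)) => // v.
  by split=> -[m hm]; exists m; rewrite vcons_scons in hm *.
- move=> k phi IH h; apply: fo_ext (fo_all (IH h)) => // v.
  by split=> hm m; move: (hm m); rewrite vcons_scons.
Qed.

Lemma edef_ind F : edef M F -> C F.
Proof.
by move=> [k [phi [h e]]]; apply: fo_ext (fo_formula h) => // v; rewrite e.
Qed.

End FoClosed.

(** Only the places below the number of variables of the formula matter. *)
Lemma edef_local M F : edef M F -> exists k, forall v w,
  (forall i, i < k -> v i = w i) -> F v -> F w.
Proof.
move=> [k [phi [_ h]]]; exists k => v w e /h hv; apply/h.
by congr (sat phi): hv; apply: funext => i; exact: e.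
Qed.

Lemma edef_mono (M M' : set symbol) F :
  (M `<=` M')%classic -> edef M F -> edef M' F.
Proof.
move=> sMM' [k [phi [h e]]]; exists k, phi; split => // {e}.
have tmono k' (t : term k') : term_over M t -> term_over M' t.
  by elim: t => [//|n f args IH] /= [/sMM' ? h']; split => // i; exact: IH.
by elim: phi h => {k} /=; intuition.
Qed.

Section Edef.
Variables (M : set symbol).

Lemma edef_ren F (r : nat -> nat) : edef M F -> edef M (fun v => F (fun i => v (r i))).
Proof.
move=> [k [phi [h e]]].
pose l := (\max_(i < k) r i).+1.
have rl (i : 'I_k) : r i < l by rewrite ltnS (leq_bigmax i).
exists l, (fren phi (fun i => Ordinal (rl i))); split.
  exact: formula_over_fren.
by move=> v; rewrite e sat_fren.
Qed.

Hypothesis strM : is_structure M.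

Lemma edef_and F G : edef M F -> edef M G -> edef M (fun v => F v /\ G v).
Proof.
move=> [k [phi [h e]]] [l [psi [h' e']]].
exists (maxn k l), (And (fren phi (widen_ord (leq_maxl k l)))
                        (fren psi (widen_ord (leq_maxr k l)))); split.
  by split; exact: formula_over_fren.
by move=> v /=; rewrite !sat_fren /= e e'.
Qed.

Lemma edef_var_eq i j : edef M (fun v => v i = v j).
Proof.
pose u : 'I_2 -> term (maxn i j).+1 := fun b => if b == ord0
   then Var (inord i) else Var (inord j).
exists (maxn i j).+1, (Atom (rel_set (fun x y : nat => x = y)) u).
split; first split.
- by apply: strM; do 4 left.
- by move=> b; rewrite /u; case: ifP.
- by move=> v /=; rewrite /rel_set /= /u /= !inordK // ltnS (leq_maxl, leq_maxr).
Qed.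

Lemma edef_closed : fo_closed (edef M).
Proof.
split.
- by move=> F G e [k [phi [h e']]]; exists k, phi; split => // v; rewrite -e.
- by move=> F [k [phi [h e]]]; exists k, (Neg phi); split => // v /=; rewrite e.
- exact: edef_and.
- move=> F [k [phi [h e]]].
  exists k, (Exists (fren phi (widen_ord (leqnSn k)))).
  split; first exact: formula_over_fren.
  move=> v /=.
  by split=> -[m h']; exists m; move: h'; rewrite e sat_fren vcons_scons.
- exact: edef_var_eq.
Qed.

End Edef.

Definition tdef (M : set symbol) (f : env -> nat) : Prop :=
  edef M (fun v => v 0 = f (fun i => v i.+1)).

Section Calculus.
Variables (M : set symbol).
Hypothesis strM : is_structure M.
Let cM := edef_closed strM.

(** Substituting definable functions: the finitely many places that matter are
quantified and tied to their intended values. *)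
Lemma edef_subst F (s : nat -> env -> nat) : edef M F ->
  (forall i, tdef M (s i)) -> edef M (fun v => F (fun i => s i v)).
Proof.
move=> dF ds; have [k loc] := edef_local dF.
have d1 : edef M (fun w => F w /\
    forall i, i \in iota 0 k -> w i = s i (fun j => w (j + k))).
  apply: edef_and => //; apply: fo_ball => // i.
  have := edef_ren (fun j => if j is j'.+1 then j' + k else i) (ds i).
  exact.
apply: fo_ext (fo_exs cM k d1) => // v.
have e l : (fun j => sapp k l v (j + k)) = v by apply: funext=> j; rewrite sapp_ge.
split=> [[l [h1 h2]]|h].
  apply: loc h1 => i ik; rewrite h2 ?e //.
  by rewrite mem_iota.
(* Conversely, the prescribed values fill the quantified places. *)
exists (fun i => s i v); split=> [|i]; last first.
  by rewrite mem_iota add0n => /andP[_ ik]; rewrite e sapp_lt.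
by apply: loc h => i ik; rewrite sapp_lt.
Qed.

Lemma tdef_subst f (s : nat -> env -> nat) : tdef M f ->
  (forall i, tdef M (s i)) -> tdef M (fun v => f (fun i => s i v)).
Proof.
move=> df ds.
pose s' i (v : env) := if i is j.+1 then s j (fun j' => v j'.+1) else v 0.
apply: (@edef_subst _ s' df) => -[|j].
  exact: (fo_eq cM 0 1).
have := edef_ren (fun j => if j is j'.+1 then j'.+2 else 0) (ds j).
exact.
Qed.

Lemma tdef_var i : tdef M (fun v => v i).
Proof. exact: (fo_eq cM 0 i.+1). Qed.

Lemma edef_not F : edef M F -> edef M (fun v => ~ F v).
Proof. exact: fo_not. Qed.

Lemma edef_or F G : edef M F -> edef M G -> edef M (fun v => F v \/ G v).
Proof. exact: fo_or. Qed.

Lemma edef_imp F G : edef M F -> edef M G -> edef M (fun v => F v -> G v).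
Proof. exact: fo_imp. Qed.

Lemma edef_iff F G : edef M F -> edef M G -> edef M (fun v => F v <-> G v).
Proof. exact: fo_iff. Qed.

Lemma edef_ex (G : env -> nat -> Prop) :
  edef M (fun w => G (fun i => w i.+1) (w 0)) ->
  edef M (fun v => exists m, G v m).
Proof. exact: (@fo_ex _ cM). Qed.

Lemma edef_all (G : env -> nat -> Prop) :
  edef M (fun w => G (fun i => w i.+1) (w 0)) ->
  edef M (fun v => forall m, G v m).
Proof. exact: (@fo_all _ cM). Qed.

Lemma edef_const (P : Prop) : edef M (fun=> P).
Proof.
have [p|np] := pselect P; first by apply: fo_ext (fo_true cM).
by apply: fo_ext (edef_not (fo_true cM)) => // v; split.
Qed.

Lemma edef_rel1 (R : nat -> Prop) f :
  edef M (fun v => R (v 0)) -> tdef M f -> edef M (fun v => R (f v)).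
Proof. by move=> dR df; apply: (edef_subst dR (s := fun=> f)). Qed.

Lemma edef_rel2 (R : nat -> nat -> Prop) f g :
  edef M (fun v => R (v 0) (v 1)) -> tdef M f -> tdef M g ->
  edef M (fun v => R (f v) (g v)).
Proof.
move=> dR df dg.
by apply: (edef_subst dR (s := fun i => if i is 0 then f else g)) => -[|i].
Qed.

Lemma edef_rel3 (R : nat -> nat -> nat -> Prop) f g h :
  edef M (fun v => R (v 0) (v 1) (v 2)) -> tdef M f -> tdef M g -> tdef M h ->
  edef M (fun v => R (f v) (g v) (h v)).
Proof.
move=> dR df dg dh.
apply: (edef_subst dR
  (s := fun i => match i with 0 => f | 1 => g | _ => h end)).
by move=> [|[|i]].
Qed.

Lemma tdef_fun1 (q : nat -> nat) f :
  edef M (fun v => v 0 = q (v 1)) -> tdef M f -> tdef M (fun v => q (f v)).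
Proof. by move=> dq df; apply: (tdef_subst (s := fun=> f) (f := fun v => q (v 0))). Qed.

Lemma tdef_fun2 (q : nat -> nat -> nat) f g :
  edef M (fun v => v 0 = q (v 1) (v 2)) -> tdef M f -> tdef M g ->
  tdef M (fun v => q (f v) (g v)).
Proof.
move=> dq df dg.
apply: (tdef_subst (s := fun i => if i is 0 then f else g)
  (f := fun v => q (v 0) (v 1))) => // -[|i] //.
Qed.

Lemma edef_eq f g : tdef M f -> tdef M g -> edef M (fun v => f v = g v).
Proof. by apply: (edef_rel2 (R := fun x y => x = y)); exact: (fo_eq cM). Qed.

Lemma edef_sym1 (f : nat -> nat) : M (fun1_symbol f) ->
  edef M (fun v => v 0 = f (v 1)).
Proof.
move=> Mf; pose u (b : 'I_2) : term 2 :=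
  if b == ord0 then Var ord0
  else App (fun v : 'I_1 -> nat => f (v ord0)) (fun=> Var ord_max).
exists 2, (Atom (rel_set (fun x y : nat => x = y)) u); split.
  split; first by apply: strM; do 4 left.
  by move=> b; rewrite /u; case: ifP.
by move=> v /=; rewrite /rel_set /= /u /=.
Qed.

Lemma edef_sym2 (f : nat -> nat -> nat) : M (fun2_symbol f) ->
  edef M (fun v => v 0 = f (v 1) (v 2)).
Proof.
move=> Mf; pose u (b : 'I_2) : term 3 :=
  if b == ord0 then Var ord0 else
  App (fun v : 'I_2 -> nat => f (v ord0) (v ord_max))
   (fun i => if i == ord0 then Var (inord 1) else Var (inord 2)).
exists 3, (Atom (rel_set (fun x y : nat => x = y)) u); split.
  split; first by apply: strM; do 4 left.
  move=> b; rewrite /u; case: ifP => // _; split => // i.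
  by case: ifP.
by move=> v /=; rewrite /rel_set /= /u /= !inordK.
Qed.

Lemma edef_symrel (G : nat -> set nat) : M (rel_symbol G) ->
  edef M (fun v => G (v 0) (v 1)).
Proof.
move=> MG.
exists 2, (Atom (rel_set G) (fun i => Var i)); split; first by [].
by move=> v /=.
Qed.

Lemma tdef_succ f : tdef M f -> tdef M (fun v => (f v).+1).
Proof.
apply: (@tdef_fun1 S); apply: edef_sym1; apply: strM.
by left; left; right.
Qed.

Lemma tdef_add f g : tdef M f -> tdef M g -> tdef M (fun v => f v + g v).
Proof. by apply: tdef_fun2; apply: edef_sym2; apply: strM; left; right. Qed.

Lemma tdef_mul f g : tdef M f -> tdef M g -> tdef M (fun v => f v * g v).
Proof. by apply: tdef_fun2; apply: edef_sym2; apply: strM; right. Qed.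

Lemma edef_leq f g : tdef M f -> tdef M g -> edef M (fun v => f v <= g v).
Proof.
move=> df dg; apply: (edef_rel2 (R := fun x y => x < y) (g := fun v => (g v).+1)) => //.
  apply: (edef_symrel (G := fun x y => x < y)); apply: strM.
  by do 3 left; right.
exact: tdef_succ.
Qed.

Lemma tdef_const n : tdef M (fun=> n).
Proof.
elim: n => [|n IH]; last exact: tdef_succ.
have d : edef M (fun v => ~ exists m, m < v 0).
  by apply: edef_not; apply: edef_ex; apply: edef_leq;
     [apply: tdef_succ|]; exact: tdef_var.
apply: fo_ext d => // v; split=> [h|-> [] //].
by case: (v 0) h => // n []; exists 0.
Qed.

End Calculus.

(** * Numbers as pairs and as streams *)

Definition pr (x y : nat) : nat := Cantor.to_nat (x, y).
Definition hd (z : nat) : nat := (Cantor.of_nat z).1.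
Definition tl (z : nat) : nat := (Cantor.of_nat z).2.

Lemma hd_pr x y : hd (pr x y) = x.
Proof. by rewrite /hd /pr Cantor.cancel_of_to. Qed.

Lemma tl_pr x y : tl (pr x y) = y.
Proof. by rewrite /tl /pr Cantor.cancel_of_to. Qed.

Lemma pr_hdtl z : pr (hd z) (tl z) = z.
Proof. by rewrite /pr /hd /tl -surjective_pairing Cantor.cancel_to_of. Qed.

Lemma addn_le_pr x y : x + y <= pr x y.
Proof. by have := Cantor.to_nat_non_decreasing x y; rewrite /pr; lia. Qed.

Lemma hd_le z : hd z <= z.
Proof. by have := addn_le_pr (hd z) (tl z); rewrite pr_hdtl; lia. Qed.

Lemma tl_le z : tl z <= z.
Proof. by have := addn_le_pr (hd z) (tl z); rewrite pr_hdtl; lia. Qed.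

Lemma tl_lt z : 0 < hd z -> tl z < z.
Proof. by have := addn_le_pr (hd z) (tl z); rewrite pr_hdtl; lia. Qed.

Lemma pr_eqE x y z : z = pr x y <-> z + z = (y + y) + (y + x) * (y + x).+1.
Proof.
have := Cantor.to_nat_spec x y; rewrite -/(pr x y) => h.
split=> [->|]; first by nia.
by move=> e; nia.
Qed.

Section CalculusPairing.
Variables (M : set symbol).
Hypothesis strM : is_structure M.
Let cM := edef_closed strM.

Lemma tdef_pr f g : tdef M f -> tdef M g -> tdef M (fun v => pr (f v) (g v)).
Proof.
apply: (tdef_fun2 strM).
apply: fo_ext (_ : edef M (fun v =>
  v 0 + v 0 = (v 2 + v 2) + (v 2 + v 1) * (v 2 + v 1).+1)) => //.
  by move=> v; rewrite -pr_eqE.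
by apply: edef_eq => //; repeat (apply: tdef_add || apply: tdef_mul ||
  apply: tdef_succ || apply: tdef_var) => //.
Qed.

Lemma tdef_hd f : tdef M f -> tdef M (fun v => hd (f v)).
Proof.
apply: (tdef_fun1 strM).
apply: fo_ext (_ : edef M (fun v => exists y, v 1 = pr (v 0) y)) => //.
  move=> v; split=> [[y ->]|->]; first by rewrite hd_pr.
  by exists (tl (v 1)); rewrite pr_hdtl.
by apply: edef_ex => //; apply: edef_eq => //; [|apply: tdef_pr];
  apply: tdef_var.
Qed.

Lemma tdef_tl f : tdef M f -> tdef M (fun v => tl (f v)).
Proof.
apply: (tdef_fun1 strM).
apply: fo_ext (_ : edef M (fun v => exists y, v 1 = pr y (v 0))) => //.
  move=> v; split=> [[y ->]|->]; first by rewrite tl_pr.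
  by exists (hd (v 1)); rewrite pr_hdtl.
by apply: edef_ex => //; apply: edef_eq => //; [|apply: tdef_pr];
  apply: tdef_var.
Qed.

Lemma tdef_mod f g : tdef M f -> tdef M g ->
  tdef M (fun v => f v %% (g v).+1).
Proof.
apply: (tdef_fun2 strM (q := fun x y => x %% y.+1)).
apply: fo_ext (_ : edef M (fun v => v 0 < (v 2).+1 /\
   exists q, v 1 = q * (v 2).+1 + v 0)) => //.
  move=> v; split=> [[h [q ->]]|->]; first by rewrite modnMDl modn_small.
  by split; [rewrite ltn_mod|exists (v 1 %/ (v 2).+1); exact: divn_eq].
apply: edef_and => //.
  by apply: edef_leq => //; repeat (apply: tdef_succ || apply: tdef_var).
apply: edef_ex => //; apply: edef_eq => //.
all: by repeat (apply: tdef_add || apply: tdef_mul || apply: tdef_succ ||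
  apply: tdef_var) => //.
Qed.

End CalculusPairing.

(** * Reflecting definability *)

(** The rules above follow the shape of a condition, so conditions written in
ordinary notation over definable relations are handled by recursion on their
syntax; a hypothesis of the form [edef M (fun v => Q (v 0) (v 1))] makes [Q]
available as a relation symbol. *)
Ltac edef_step :=
  cbv beta;
  match goal with
  | |- tdef _ (fun v => v _) => refine (tdef_var _ _)
  | |- tdef _ (fun _ => ?n) => refine (tdef_const _ n)
  | |- tdef _ (fun v => (@?f v).+1) => refine (tdef_succ _ _)
  | |- tdef _ (fun v => @?f v + @?g v) => refine (tdef_add _ _ _)
  | |- tdef _ (fun v => @?f v * @?g v) => refine (tdef_mul _ _ _)
  | |- tdef _ (fun v => pr (@?f v) (@?g v)) => refine (tdef_pr _ _ _)
  | |- tdef _ (fun v => hd (@?f v)) => refine (tdef_hd _ _)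
  | |- tdef _ (fun v => tl (@?f v)) => refine (tdef_tl _ _)
  | |- tdef _ (fun v => (@?f v) %% (@?g v).+1) => refine (tdef_mod _ _ _)
  | |- edef _ (fun v => @?f v = @?g v) => refine (edef_eq _ _ _)
  | |- edef _ (fun v => is_true (@?f v <= @?g v)) => refine (edef_leq _ _ _)
  | H : edef ?M (fun v => ?R (v 0)) |- edef ?M (fun v => ?R (@?f v)) =>
      refine (edef_rel1 _ H _)
  | H : edef ?M (fun v => ?R (v 0) (v 1)) |-
      edef ?M (fun v => ?R (@?f v) (@?g v)) =>
      refine (edef_rel2 _ H _ _)
  | H : edef ?M (fun v => ?R (v 0) (v 1) (v 2)) |-
      edef ?M (fun v => ?R (@?f v) (@?g v) (@?h v)) =>
      refine (edef_rel3 _ H _ _ _)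
  | |- is_structure _ => assumption
  | |- edef _ (fun _ => ?P) => refine (edef_const _ P)
  | |- edef _ (fun v => @?F v /\ @?G v) => refine (edef_and _ _)
  | |- edef _ (fun v => @?F v \/ @?G v) => refine (edef_or _ _ _)
  | |- edef _ (fun v => ~ @?F v) => refine (edef_not _ _)
  | |- edef _ (fun v => @?F v <-> @?G v) => refine (edef_iff _ _ _)
  | |- edef _ (fun v => exists m, @?G v m) => refine (edef_ex _ (G := G) _)
  | |- edef _ (fun v => forall m : nat, @?G v m) => refine (edef_all _ (G := G) _)
  | |- edef _ (fun v => @?F v -> @?G v) => refine (edef_imp _ _ _)
  end.

Ltac edef := repeat edef_step.


Notation rdef M G := (edef M (fun v => G (v 0) (v 1))).

(** A formula in more variables than places is cured by identifying the surplus
variables with one of the given ones; this is where positive arity matters. *)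
Lemma definable_edef M k (X : set ('I_k.+1 -> nat)) :
  definable M X <-> edef M (fun v => X (fun i => v i)).
Proof.
split=> [[phi [h ->]]|[l [phi [h e]]]]; first by exists k.+1, phi.
exists (fren phi (fun i => inord i)); split; first exact: formula_over_fren.
apply/predeqP => u; rewrite sat_fren.
have : X u <-> sat phi (fun i => u (inord i)).
  rewrite -(e (fun i => u (inord i))).
  suff -> : (fun i : 'I_k.+1 => u (inord i)) = u by [].
  by apply: funext => i; rewrite inord_val.
by [].
Qed.

Lemma DefE M X : Def M X <-> edef M (fun v => X (v 0)).
Proof. exact: definable_edef. Qed.

Lemma definable_rel M G : definable M (rel_set G) <-> rdef M G.
Proof. exact: definable_edef. Qed.

Lemma edef_symbol M s : is_structure M -> M s -> edef M (sym_ext s).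
Proof.
move=> strM; case: s => [n A|n f] Ms.
  by exists n.+1, (Atom A (fun i => Var i)).
pose u (b : 'I_2) : term n.+1 :=
  if b == ord0 then Var ord0 else App f (fun i => Var (lift ord0 i)).
exists n.+1, (Atom (rel_set (fun x y : nat => x = y)) u); split.
  split; first by apply: strM; do 4 left.
  by move=> b; rewrite /u; case: ifP.
by move=> v /=; rewrite /rel_set /= /u /=.
Qed.

(** A number is read as the stream of the heads of its iterated tails, so that
quantifying the first variable is projecting along [pr]. *)
Definition nthc (c i : nat) : nat := hd (iter i tl c).

Fixpoint enc (n : nat) (v : env) : nat :=
  if n is m.+1 then pr (v 0) (enc m (fun i => v i.+1)) else 0.

Lemma nthc_enc n v i : i < n -> nthc (enc n v) i = v i.
Proof.
elim: n v i => [//|n IH] v [_|i] /=; first by rewrite /nthc /= hd_pr.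
by rewrite ltnS /nthc iterSr /= tl_pr => /IH; rewrite /nthc => ->.
Qed.

Lemma nthc_pr m c : nthc (pr m c) = scons m (nthc c).
Proof.
by apply: funext => -[|i]; rewrite /nthc ?iterSr /= ?hd_pr ?tl_pr.
Qed.

Lemma tdef_nthc M f i : is_structure M -> tdef M f ->
  tdef M (fun v => nthc (f v) i).
Proof.
move=> strM df; apply: tdef_hd => //.
by elim: i => [//|i IH] /=; apply: tdef_tl.
Qed.

Lemma tdef_enc M n r : is_structure M -> tdef M (fun v => enc n (fun i => v (r i))).
Proof.
move=> strM; elim: n r => [|n IH] r /=; first exact: tdef_const.
apply: tdef_pr => //; exact: (tdef_var strM).
Qed.

(** * Comparing structures *)

Definition def_le (M M' : set symbol) : Prop :=
  forall F, edef M F -> edef M' F.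

Lemma edef_ext M F G : is_structure M -> (forall v, F v <-> G v) ->
  edef M F -> edef M G.
Proof. by move=> strM; exact: (fo_ext (edef_closed strM)). Qed.

(** Definable sets of numbers determine all definable relations, because a tuple
can be coded by one number. *)
Lemma def_le_unary M M' : is_structure M -> is_structure M' ->
  Def M `<=` Def M' -> def_le M M'.
Proof.
move=> strM strM' sMM' F dF; have [k loc] := edef_local dF.
pose X := [set x | F (nthc x)].
have : Def M X.
  apply/DefE; apply: (edef_subst strM dF (s := fun i v => nthc (v 0) i)) => i.
  by apply: tdef_nthc => //; exact: tdef_var.
move=> /sMM'/DefE dX.
have := edef_rel1 strM' dX (tdef_enc k id strM').
apply: edef_ext => // v; rewrite /X /=.
by split; apply: loc => i ik; rewrite nthc_enc.
Qed.

Lemma Def_sub M M' : def_le M M' -> Def M `<=` Def M'.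
Proof. by move=> h X /DefE /h /DefE. Qed.

(** Formulas are built from symbols by first-order operations. *)
Lemma def_le_symbols M M' : is_structure M' ->
  (forall s, M s -> edef M' (sym_ext s)) -> def_le M M'.
Proof. by move=> strM' h F; apply: edef_ind => //; exact: edef_closed. Qed.

Lemma expand_str M G : is_structure M -> is_structure (expand M G).
Proof. by move=> strM s /strM; left. Qed.

Lemma sub_expand M G : M `<=` expand M G.
Proof. by left. Qed.

Lemma rdef_expand M G : rdef (expand M G) G.
Proof. by apply: edef_symrel; right. Qed.

Lemma def_le_expand M M' G : is_structure M -> is_structure M' ->
  def_le M M' -> rdef M' G -> def_le (expand M G) M'.
Proof.
move=> strM strM' h dG; apply: def_le_symbols => // s [Ms|->].
  by apply: h; exact: edef_symbol.
by [].
Qed.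

(** A universal predicate carries every definable set as a column, so it can
replace the whole structure. *)
Lemma def_le_universal M M' P : is_structure M -> is_structure M' ->
  universal M P -> rdef M' P -> def_le M M'.
Proof.
move=> strM strM' uP dP; apply: def_le_unary => // X /uP [i _ <-].
apply/DefE; have hi := tdef_const strM' i.
exact: (edef_rel2 strM' dP hi (tdef_var strM' 0)).
Qed.

(** Cantor's diagonal. *)
Lemma universal_not_rdef M U : is_structure M -> universal M U -> ~ rdef M U.
Proof.
move=> strM uU dU.
have : Def M [set n | ~ U n n] by apply/DefE => /=; edef.
move=> /uU [i _ e].
have : U i i <-> ~ U i i by rewrite {1}e.
tauto.
Qed.

(** * Recursion on numbers and truth over one relation *)

(** A function whose value at [n] is determined by its values below [n] is found
by iterating: the value at [n] is stable after [n] + 1 rounds. *)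
Section LocalFixpoint.
Variables (U : Type) (F : (nat -> U) -> nat -> U) (d : U).
Hypothesis F_local : forall f g n, (forall m, m < n -> f m = g m) -> F f n = F g n.

Definition lfix n : U := iter n.+1 F (fun=> d) n.

Lemma lfixE n : lfix n = F lfix n.
Proof.
have stable a b m : m < a -> m < b ->
    iter a F (fun=> d) m = iter b F (fun=> d) m.
  elim/ltn_ind: m a b => m IH [//|a] [//|b] ma mb /=.
  by apply: F_local => k km; apply: IH => //; lia.
by rewrite {1}/lfix iterS; apply: F_local => m mn; exact: stable.
Qed.

Lemma lfix_unique f n : (forall m, m < n -> f m = F f m) ->
  forall m, m < n -> f m = lfix m.
Proof.
move=> h; elim/ltn_ind => m IH mn.
by rewrite h // lfixE; apply: F_local => k km; apply: IH => //; lia.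
Qed.

End LocalFixpoint.

(** One clause of the definition of truth. An index is a formula in which sets
of streams stand for formulas: basic relations from [A], the relation [V],
negated conjunction, quantification of the first place, a dummy first place, and
the exchange of the first two places. The last two rearrangements are definable
without coding finite sequences and, with equality of the first two places,
give equality of any two places. *)
Definition step (A V G : nat -> set nat) (i x : nat) : Prop :=
  let j := tl i in
  match hd i with
  | 0 => A j x
  | 1 => V (hd x) (hd (tl x))
  | 2 => ~ (G (hd j) x /\ G (tl j) x)
  | 3 => exists m, G j (pr m x)
  | 4 => G j (tl x)
  | _ => G j (pr (hd (tl x)) (pr (hd x) (tl (tl x))))
  end.

(** The same clauses as a disjunction, the shape that [edef] decomposes. *)
Lemma stepE : step = fun A V G i x =>
  (hd i = 0 /\ A (tl i) x) \/
  (hd i = 1 /\ V (hd x) (hd (tl x))) \/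
  (hd i = 2 /\ ~ (G (hd (tl i)) x /\ G (tl (tl i)) x)) \/
  (hd i = 3 /\ exists m, G (tl i) (pr m x)) \/
  (hd i = 4 /\ G (tl i) (tl x)) \/
  (4 < hd i /\ G (tl i) (pr (hd (tl x)) (pr (hd x) (tl (tl x))))).
Proof.
do 5 apply: funext => ?; apply: propext; rewrite /step.
case: (hd _) => [|[|[|[|[|t]]]]] /=;
  by split; intuition (try done).
Qed.

Lemma step_local A V f g i :
  (forall j, j < i -> f j = g j) -> step A V f i = step A V g i.
Proof.
move=> h; apply: funext => x; rewrite /step.
case e : (hd i) => [|[|t]] //.
have ti : tl i < i by apply: tl_lt; rewrite e.
rewrite (h (tl i)) // (h (hd (tl i))) ?(h (tl (tl i))) //.
  exact: leq_ltn_trans (tl_le _) ti.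
exact: leq_ltn_trans (hd_le _) ti.
Qed.

Definition Tr (A V : nat -> set nat) : nat -> set nat := lfix (step A V) set0.

Lemma TrE A V i x : Tr A V i x <-> step A V (Tr A V) i x.
Proof. by rewrite {1}/Tr lfixE //; exact: step_local. Qed.

Lemma Tr_unique A V (G : nat -> set nat) n :
  (forall i, i < n -> forall x, G i x <-> step A V G i x) ->
  forall i, i < n -> forall x, G i x <-> Tr A V i x.
Proof.
move=> h i lti x.
rewrite (@lfix_unique _ (step A V) set0 (@step_local A V) G n) //.
by move=> m /h hm; apply: funext => y; apply: propext.
Qed.

Lemma Tr_unique_all A V (G : nat -> set nat) :
  (forall i x, G i x <-> step A V G i x) -> G = Tr A V.
Proof.
move=> h; apply: funext => i; apply: funext => x; apply: propext.
by apply: (@Tr_unique _ _ _ i.+1).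
Qed.

(** Truth for one fixed formula is definable, although truth is not. *)
Lemma rdef_Tr M A V i : is_structure M -> rdef M A -> rdef M V ->
  edef M (fun v => Tr A V i (v 0)).
Proof.
move=> strM dA dV; elim/ltn_ind: i => i IH.
apply: (@edef_ext _ (fun v => step A V (Tr A V) i (v 0))) => //.
  by move=> v; rewrite -TrE.
have dG : forall j, (0 < hd i -> j <= tl i) -> 0 < hd i ->
    edef M (fun v => Tr A V j (v 0)).
  by move=> j h pi; apply: IH; apply: leq_ltn_trans (tl_lt pi); exact: h.
rewrite /step; case: (hd i) dG => [|[|[|[|[|t]]]]] dG.
- by edef.
- by edef.
- have := dG (hd (tl i)) (fun=> hd_le _) isT.
  have := dG (tl (tl i)) (fun=> tl_le _) isT.
  by move=> ? ?; edef.
all: have := dG (tl i) (fun=> leqnn _) isT; move=> ?; edef.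
Qed.

Definition column (P : nat -> set nat) (k : nat) : nat -> set nat :=
  fun i x => P k (pr i x).

(** Truth read off from a universal predicate [P]: some column of [P] obeys the
clauses up to [i] and puts [x] in the [i]-th set. *)
Definition truth_via (A P V : nat -> set nat) (i x : nat) : Prop :=
  exists k, (forall j, j < i.+1 -> forall y,
    column P k j y <-> step A V (column P k) j y) /\ column P k i x.

(** Binary relations enter a universal predicate through the pairing. *)
Lemma column_of_rdef M P V : is_structure M -> universal M P -> rdef M V ->
  exists k, column P k = V.
Proof.
move=> strM uP dV.
have : Def M [set z | V (hd z) (tl z)] by apply/DefE => /=; edef.
move=> /uP [k _ e]; exists k; apply: funext => i; apply: funext => x.
by rewrite /column e /= hd_pr tl_pr.
Qed.

(** Truth about formulas below a bound is definable, hence it is a column; every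
column obeying the clauses below the bound agrees with it there. *)
Lemma truth_viaE M A P V i x : is_structure M -> universal M P ->
  rdef M A -> rdef M V -> truth_via A P V i x <-> Tr A V i x.
Proof.
move=> strM uP dA dV; split=> [[k [h1 h2]]|h].
  exact/(Tr_unique h1 (ltnSn i)).
pose G j y := j < i.+1 /\ Tr A V j y.
have dG : rdef M G.
  apply: (@edef_ext _ (fun v => ~ forall j, j \in iota 0 i.+1 ->
      ~ (v 0 = j /\ Tr A V j (v 1)))) => //.
    move=> v; split=> [n|[l t] /(_ (v 0))]; last first.
      by rewrite mem_iota add0n l => /(_ isT); apply; split.
    apply: contrapT => n'; apply: n => j; rewrite mem_iota add0n => /andP[_ l].
    by move=> [e t]; apply: n'; rewrite /G e.
  apply: edef_not => //; apply: fo_ball; first exact: edef_closed.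
  by move=> j; have d := rdef_Tr j strM dA dV; edef.
have [k e] := column_of_rdef strM uP dG.
exists k; rewrite e; split; last by split.
move=> j ji y; rewrite /G TrE.
rewrite -(@step_local A V (Tr A V) G); first by split=> [[]|].
move=> m mj; apply: funext => z; apply: propext; rewrite /G.
by split=> [|[]] //; split => //; lia.
Qed.

(** * Finite structures *)

(** Finitely many symbols are kept together in the rows of one definable
relation. *)
Definition codes (N : set symbol) (A : nat -> set nat) : Prop :=
  rdef N A /\
  forall s, N s -> exists k, forall c, A k c <-> sym_ext s (nthc c).

Lemma finite_coded N : is_structure N -> finite_set N -> exists A, codes N A.
Proof.
move=> strN [n /card_set_bijP [f [fN finj fsurj]]].
pose A k := [set c | exists s, [/\ N s, f s = k & sym_ext s (nthc c)]].
have Ak s : N s -> forall c, A (f s) c <-> sym_ext s (nthc c).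
  move=> Ns c; split=> [[s' [Ns' e h]]|h]; last by exists s.
  by rewrite -(finj s' s) ?inE.
exists A; split; last by move=> s Ns; exists (f s); exact: Ak.
have dAk k : edef N (fun v => A k (v 0)).
  have [[s [Ns <-]]|nex] := pselect (exists s, N s /\ f s = k).
    apply: (@edef_ext _ (fun v => sym_ext s (nthc (v 0)))) => //.
      by move=> v; split=> /Ak; exact.
    apply: (edef_subst strN (edef_symbol strN Ns)
      (s := fun i v => nthc (v 0) i)) => i.
    by apply: tdef_nthc => //; exact: tdef_var.
  apply: (@edef_ext _ (fun=> False)) => //; last exact: edef_const.
  by move=> v; split=> // -[s [Ns e _]]; apply: nex; exists s.
apply: (@edef_ext _ (fun v => ~ forall k, k \in iota 0 n ->
    ~ (v 0 = k /\ A k (v 1)))) => //.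
  move=> v; split=> [h|h].
    apply: contrapT => n'; apply: h => k _ [e t]; apply: n'; by rewrite e.
  move=> /(_ (v 0)); rewrite mem_iota add0n.
  case: (h) => s [Ns e _]; rewrite -e.
  have /= -> := fN _ Ns; move=> /(_ isT); apply; split => //.
  by rewrite e.
apply: edef_not => //; apply: fo_ball; first exact: edef_closed.
by move=> k; have d := dAk k; edef.
Qed.

(** Conditions of the form [Tr A V i] on streams are closed under first-order
operations. Equality of places [i] and [j] starts from equality of places 0 and
1: a dummy first place shifts both, and exchanging the first two brings the lower
one back to 0. *)
Lemma Tr_complete N A V F : is_structure N -> codes N A ->
  edef (expand N V) F -> exists i, forall c, Tr A V i c <-> F (nthc c).
Proof.
move=> strN [_ cA].
pose C (F : env -> Prop) := exists i, forall c, Tr A V i c <-> F (nthc c).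
have Cext F1 F2 : (forall v, F1 v <-> F2 v) -> C F1 -> C F2.
  by move=> e [i h]; exists i => c; rewrite h.
have Cnand F1 F2 : C F1 -> C F2 -> C (fun v => ~ (F1 v /\ F2 v)).
  move=> [i hi] [j hj]; exists (pr 2 (pr i j)) => c.
  by rewrite TrE /step !(hd_pr, tl_pr) hi hj.
have Cnot F1 : C F1 -> C (fun v => ~ F1 v).
  by move=> c1; apply: Cext (Cnand _ _ c1 c1) => v; tauto.
have Cweak F1 : C F1 -> C (fun v => F1 (fun i => v i.+1)).
  move=> [i hi]; exists (pr 4 i) => c.
  rewrite TrE /step !(hd_pr, tl_pr) hi.
  suff -> : nthc (tl c) = (fun j => nthc c j.+1) by [].
  by apply: funext => j; rewrite /nthc iterSr.
have Ceq01 : C (fun v => v 0 = v 1).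
  have [|k hk] := cA (rel_symbol (fun x y : nat => x = y)).
    by apply: strN; do 4 left.
  exists (pr 0 k) => c; rewrite TrE /step hd_pr tl_pr hk.
  by rewrite /rel_symbol /= /rel_set.
have Ceq0 l : C (fun v => v 0 = v l.+1).
  elim: l => [//|l /Cweak [i hi]]; exists (pr 5 i) => c.
  have -> : nthc c l.+2 = nthc (tl (tl c)) l by rewrite /nthc !iterSr.
  by rewrite TrE /step !(hd_pr, tl_pr) hi !nthc_pr.
have Ceqlt i l : C (fun v => v i = v (i + l.+1)).
  elim: i => [|i IH]; first exact: Ceq0.
  exact: (Cweak _ IH).
apply: (@edef_ind C).
- split => //.
  + move=> F1 F2 c1 c2; apply: Cext (Cnot _ (Cnand _ _ c1 c2)) => v.
    by split=> [|h n]; [exact: contrapT|].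
  + move=> F1 [i hi]; exists (pr 3 i) => c.
    rewrite TrE /step !(hd_pr, tl_pr).
    by split=> -[m h]; exists m; move: h; rewrite hi nthc_pr.
  + move=> i j; case: (ltngtP i j) => [ij|ji|->].
    * by have := Ceqlt i (j - i.+1); congr C; apply: funext => v; congr (_ = v _); lia.
    * apply: Cext (Ceqlt j (i - j.+1)) => v.
      have -> : j + (i - j.+1).+1 = i by lia.
      by split.
    * apply: Cext (Cnand _ _ Ceq01 (Cnot _ Ceq01)) => v.
      by split=> // _ [].
- move=> s [Ns|->].
    have [k hk] := cA s Ns; exists (pr 0 k) => c.
    by rewrite TrE /step hd_pr tl_pr hk.
  exists (pr 1 0) => c; rewrite TrE /step !(hd_pr, tl_pr).
  by rewrite /rel_symbol /= /rel_set.
Qed.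

(** A formula with one free variable [x] is evaluated at the stream
[x], 0, 0 and so on. *)
Definition col (G : nat -> set nat) (i : nat) : set nat :=
  [set x | G i (pr x 0)].

Lemma Def_col_Tr N A V X : is_structure N -> codes N A ->
  Def (expand N V) X -> exists i, col (Tr A V) i = X.
Proof.
move=> strN cA /DefE /(Tr_complete strN cA) [i hi]; exists i.
apply: funext => x; apply: propext.
by rewrite /col /= hi /nthc /= hd_pr.
Qed.

Lemma Def_Tr_col M A V i : is_structure M -> rdef M A -> rdef M V ->
  Def M (col (Tr A V) i).
Proof.
move=> strM dA dV; apply/DefE; have d := rdef_Tr i strM dA dV.
by rewrite /col /=; edef.
Qed.

(** * Goedel's beta function *)

Definition beta (u w k : nat) : nat := u %% (w * k.+1).+1.

(** A common divisor of the two moduli divides [w * (b - a)] and is coprime to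
[w], so it divides [b - a], which divides [w]. *)
Lemma beta_coprime w n a b : (forall d, 0 < d -> d <= n -> d %| w) ->
  a < b -> b <= n -> coprime (w * a.+1).+1 (w * b.+1).+1.
Proof.
move=> hw ab bn.
set g := gcdn (w * a.+1).+1 (w * b.+1).+1.
have ga : g %| (w * a.+1).+1 by exact: dvdn_gcdl.
have gb : g %| (w * b.+1).+1 by exact: dvdn_gcdr.
have cgw : coprime g w.
  apply: coprime_dvdl ga _.
  exact: coprime_dvdr (dvdn_mulr a.+1 (dvdnn w)) (coprimeSn _).
have : g %| w * (b - a).
  have -> : w * (b - a) = (w * b.+1).+1 - (w * a.+1).+1 by nia.
  exact: dvdn_sub.
rewrite Gauss_dvdr // => /dvdn_trans /(_ (hw (b - a) _ _)) gw.
have /gw {}gw : 0 < b - a by lia.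
have gw' : g %| w by apply: gw; lia.
by rewrite /coprime -/g; move: cgw; rewrite /coprime (gcdn_idPl gw').
Qed.

(** Chinese remainders for the moduli [w * k.+1 + 1]; they exceed the
values of [h] because [w] is the factorial of a bound for them. *)
Lemma beta_surj (h : env) n : exists u w, forall k, k < n -> beta u w k = h k.
Proof.
pose B := n + \max_(k < n) h k.
pose w := B`!.
have hw d : 0 < d -> d <= B -> d %| w by move=> *; apply: dvdn_fact; apply/andP.
pose m k := (w * k.+1).+1.
have [u hu] : exists u, forall k, k < n -> u = h k %[mod m k].
  elim: {-2}n (leqnn n) => [|j IH] jn; first by exists 0.
  have [u hu] := IH (ltnW jn).
  have cop : coprime (\prod_(k < j) m k) (m j).
    elim/big_ind: _ => [|x y cx cy|k _]; first exact: coprime1n.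
      by rewrite coprimeMl cx cy.
    by apply: (@beta_coprime w B) => //; rewrite /B; lia.
  exists (chinese (\prod_(k < j) m k) (m j) u (h j)) => k.
  rewrite ltnS leq_eqVlt => /orP[/eqP ->|kj]; first exact: chinese_modr.
  rewrite -hu //.
  have dm : m k %| \prod_(k < j) m k.
    by rewrite (bigD1 (Ordinal kj)) //= dvdn_mulr.
  by rewrite -(modn_dvdm _ dm) chinese_modl // modn_dvdm.
exists u, w => k kn; rewrite /beta -/(m k) hu // modn_small //.
have hk : h k <= \max_(i < n) h i := leq_bigmax (Ordinal kn).
have Bw : B <= w by exact: fact_geq.
rewrite /m ltnS; apply: (leq_trans hk); nia.
Qed.

(** * Jump hierarchies along a relation *)

Section Hierarchy.
Variables (A : nat -> set nat) (R : nat -> nat -> Prop).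

(** A family of enumerations indexed by numbers [c] is a single relation: row
[pr c i] is the [i]-th set of level [c]. Each level is to be the truth predicate
for the part of the family below it. *)
Definition lower (G : nat -> set nat) (c : nat) : nat -> set nat :=
  fun n x => R (hd n) c /\ G n x.

Definition level (G : nat -> set nat) (c : nat) : nat -> set nat :=
  fun i => G (pr c i).

Definition truthful (G : nat -> set nat) (c : nat) : Prop :=
  forall i x, level G c i x <-> step A (lower G c) (level G c) i x.

Definition hierarchy_below (b : nat) (G : nat -> set nat) : Prop :=
  forall c, R c b -> truthful G c.

(** What ill-foundedness can hide behind: no descent of [R] is visible to the
sets enumerated at the levels below [b]. *)
Definition seems_well_founded (b : nat) (G : nat -> set nat) : Prop :=
  forall c i y, R c b -> col (level G c) i y ->
  exists2 w, col (level G c) i w & forall y', R y' w -> ~ col (level G c) i y'.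
Lemma truthful_level G c : truthful G c -> level G c = Tr A (lower G c).
Proof. exact: Tr_unique_all. Qed.

(** The recursion goes through accessibility proofs, and [true_hier] forgets
which proof was used. *)
Fixpoint acc_level c (a : Acc R c) {struct a} : nat -> set nat :=
  Tr A (fun n x => exists p : R (hd n) c, acc_level (Acc_inv a p) (tl n) x).

Definition true_hier : nat -> set nat :=
  fun n x => exists a : Acc R (hd n), acc_level a (tl n) x.

Lemma true_hier_truthful c : Acc R c -> truthful true_hier c.
Proof.
move=> a.
rewrite /truthful.
suff -> : level true_hier c = Tr A (lower true_hier c) by move=> i x; exact: TrE.
have accE (a' : Acc R c) : acc_level a' = Tr A (lower true_hier c).
  case: a' => a' /=; congr Tr; apply: funext => n; apply: funext => x.
  apply: propext; split=> [[p h]|[p [b h]]].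
    by split=> //; exists (a' _ p).
  by exists p; rewrite (Prop_irrelevance (a' _ p) b).
apply: funext => i; apply: funext => x; apply: propext.
rewrite /level /true_hier hd_pr tl_pr; split=> [[a' h]|h].
  by rewrite -(accE a').
by exists a; rewrite accE.
Qed.

Hypothesis R_trans : forall a b c, R a b -> R b c -> R a c.

Lemma hier_down b c G : R c b -> hierarchy_below b G -> hierarchy_below c G.
Proof. by move=> cb h d dc; apply: h; exact: R_trans cb. Qed.

(** Truth over a given relation is unique, so hierarchies can only differ along
the ill-founded part. *)
Lemma hier_unique b G G' : Acc R b -> hierarchy_below b G -> hierarchy_below b G' ->
  lower G b = lower G' b.
Proof.
elim=> {}b _ IH h h'; apply: funext => n; apply: funext => x; apply: propext.
have e c : R c b -> level G c = level G' c.
  move=> cb; rewrite (truthful_level (h _ cb)) (truthful_level (h' _ cb)).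
  by rewrite (IH c cb (hier_down cb h) (hier_down cb h')).
have {}e : R (hd n) b -> G n x = G' n x.
  by move=> /e /(congr1 (fun f => f (tl n) x)); rewrite /level pr_hdtl.
by rewrite /lower; split=> -[nb]; rewrite (e nb).
Qed.

Lemma true_hier_hier b : Acc R b -> hierarchy_below b true_hier.
Proof. by move=> ab c cb; apply: true_hier_truthful; exact: Acc_inv cb. Qed.

End Hierarchy.

(** * A tree of attempts to build a hierarchy along itself *)

(** Nodes are numbers coding finite sequences by the beta function. Several
numbers code the same sequence, which does no harm: [extends] compares the
sequences. *)
Definition len (s : nat) : nat := hd s.
Definition ent (s k : nat) : nat := beta (hd (tl s)) (tl (tl s)) k.

Definition extends (t s : nat) : Prop :=
  len s < len t /\ forall k, k < len s -> ent t k = ent s k.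

Definition tree_rel (T : nat -> Prop) (t s : nat) : Prop := T t /\ extends t s.

Definition node (k : nat) : nat := hd (hd k).
Definition idx (k : nat) : nat := tl (hd k).
Definition arg (k : nat) : nat := tl k.

(** An attempt is a function [h] whose value [h (pr n x)] has two parts. The head
tells whether [x] belongs to row [n] of the family, being 0 if not, and
otherwise 1 more than a witness in case the row is that of a quantified formula.
The tail of [h n] is, when column [n] is not empty, a minimal element of it.
The clauses say that [h] describes a hierarchy below 0 that seems well-founded,
and each instance looks at three values of [h] only. *)
Definition clauses (A : nat -> set nat) (T : nat -> Prop)
    (k0 k1 k2 h0 h1 h2 : nat) : Prop :=
  tree_rel T (node k0) 0 ->
  (hd (idx k0) = 0 -> (0 < hd h0 <-> A (tl (idx k0)) (arg k0))) /\
  (hd (idx k0) = 1 -> k1 = pr (hd (arg k0)) (hd (tl (arg k0))) ->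
     (0 < hd h0 <-> tree_rel T (node k1) (node k0) /\ 0 < hd h1)) /\
  (hd (idx k0) = 2 ->
     k1 = pr (pr (node k0) (hd (tl (idx k0)))) (arg k0) ->
     k2 = pr (pr (node k0) (tl (tl (idx k0)))) (arg k0) ->
     (0 < hd h0 <-> ~ (0 < hd h1 /\ 0 < hd h2))) /\
  (hd (idx k0) = 3 ->
     k1 = pr (pr (node k0) (tl (idx k0))) (pr (hd (arg k1)) (arg k0)) ->
     (0 < hd h1 -> 0 < hd h0) /\ (hd h0 = (hd (arg k1)).+1 -> 0 < hd h1)) /\
  (hd (idx k0) = 4 ->
     k1 = pr (pr (node k0) (tl (idx k0))) (tl (arg k0)) ->
     (0 < hd h0 <-> 0 < hd h1)) /\
  (4 < hd (idx k0) ->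
     k1 = pr (pr (node k0) (tl (idx k0)))
       (pr (hd (tl (arg k0))) (pr (hd (arg k0)) (tl (tl (arg k0))))) ->
     (0 < hd h0 <-> 0 < hd h1)) /\
  (0 < hd h0 -> k0 = pr (hd k0) (pr (hd (arg k0)) 0) -> k1 = hd k0 ->
     k2 = pr (hd k0) (pr (hd (arg k2)) 0) ->
     (hd (arg k2) = tl h1 -> 0 < hd h2) /\
     (tree_rel T (hd (arg k2)) (tl h1) -> ~ 0 < hd h2)).

(** A finite sequence of length [n] is tested at places below [n] only, and the
tree is consulted at numbers below [n] only; as [n] is at most the code of the
sequence, the tree can be defined by recursion in terms of its own order. *)
Definition coherent (A : nat -> set nat) (T : nat -> Prop) (s : nat) : Prop :=
  forall k0 k1 k2, k0 < len s -> k1 < len s -> k2 < len s ->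
    clauses A T k0 k1 k2 (ent s k0) (ent s k1) (ent s k2).

Lemma node_le k : node k <= k.
Proof. exact: leq_trans (hd_le _) (hd_le _). Qed.

Lemma coherent_local A (T T' : nat -> Prop) s :
  (forall m, m < s -> T m = T' m) -> coherent A T s = coherent A T' s.
Proof.
move=> e.
have re a b : a < s -> tree_rel T a b = tree_rel T' a b.
  by move=> l; rewrite /tree_rel e.
have ls : len s <= s := hd_le s.
have ce k0 k1 k2 h0 h1 h2 : k0 < len s -> k1 < len s -> k2 < len s ->
    clauses A T k0 k1 k2 h0 h1 h2 = clauses A T' k0 k1 k2 h0 h1 h2.
  move=> l0 l1 l2; rewrite /clauses.
  rewrite (re (node k0) 0) ?(re (node k1) (node k0)) ?(re (hd (arg k2))) //.
  - have := hd_le (arg k2); have := tl_le k2; rewrite -/(arg k2); lia.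
  - have := node_le k1; lia.
  - have := node_le k0; lia.
apply: propext; split=> h k0 k1 k2 l0 l1 l2.
  by rewrite -ce //; exact: h.
by rewrite ce //; exact: h.
Qed.

Section Tree.
Variables (N : set symbol) (A : nat -> set nat).
Hypotheses (strN : is_structure N) (dA : rdef N A).

Definition tree : nat -> Prop := lfix (coherent A) False.

Lemma treeE s : tree s = coherent A tree s.
Proof. exact: lfixE (@coherent_local A) s. Qed.

(** The recursion is replaced by the existence of a beta code for an initial
segment of the tree. *)
Lemma edef_tree : edef N (fun v => tree (v 0)).
Proof.
(* [B u w c] reads membership of [c] off the code; one value of the code is
reserved for yes. *)
pose good (T : nat -> Prop) s := (forall c, c <= s -> (T c <-> coherent A T c)).
pose B u w c := beta u w c = 1.
apply: (@edef_ext _ (fun v => exists u w, good (B u w) (v 0) /\ B u w (v 0))) => //.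
  move=> v; split=> [[u [w [g b]]]|t].
    rewrite /tree -(@lfix_unique _ _ False (@coherent_local A) (B u w) (v 0).+1) //.
    by move=> m lm; apply: propext; exact: g.
  have [u [w h]] := beta_surj (fun c => if `[< tree c >] then 1 else 0) (v 0).+1.
  have BE c : c <= v 0 -> B u w c = tree c.
    move=> lc; rewrite /B h //; apply: propext.
    by case: asboolP => // n; split.
  exists u, w; split; last by rewrite BE.
  move=> c lc; rewrite BE // treeE; rewrite (@coherent_local A tree (B u w)) //.
  by move=> m mc; rewrite BE //; lia.
rewrite /good /coherent /clauses /tree_rel /extends /B /node /idx /arg /ent /len.
rewrite /beta.
by edef.
Qed.

Notation R := (tree_rel tree).

Lemma rdef_tree_rel : rdef N R.
Proof.
have d := edef_tree; rewrite /tree_rel /extends /ent /len /beta; edef.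
Qed.

Lemma tree_rel_trans a b c : R a b -> R b c -> R a c.
Proof.
move=> [Ta [lab eab]] [Tb [lbc ebc]]; split=> //; split; first lia.
by move=> k lk; rewrite eab ?ebc //; lia.
Qed.

Definition branch (h : env) : Prop := forall k0 k1 k2,
  clauses A tree k0 k1 k2 (h k0) (h k1) (h k2).

(** All codes of the finite parts of [h] are nodes of the tree. *)
Lemma branch_not_acc h : branch h -> ~ Acc R 0.
Proof.
move=> bh.
suff key s : Acc R s -> (forall k, k < len s -> ent s k = h k) -> False.
  by move=> /key; apply => k; rewrite /len /hd.
elim=> {}s _ IH hs.
have [u [w e]] := beta_surj h (len s).+1.
(* A code of the initial segment of [h] of length one more than [s]. *)
pose t := pr (len s).+1 (pr u w).
have lt : len t = (len s).+1 by rewrite /len hd_pr.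
have et k : k < (len s).+1 -> ent t k = h k.
  by move=> lk; rewrite /ent !(hd_pr, tl_pr) e.
apply: (IH t); last by rewrite lt.
split; last first.
  split; first by rewrite lt.
  by move=> k lk; rewrite et ?hs //; lia.
by rewrite treeE => k0 k1 k2; rewrite lt => *; rewrite !et //; exact: bh.
Qed.

Lemma not_acc_pred (Q : nat -> nat -> Prop) s : ~ Acc Q s ->
  exists2 t, Q t s & ~ Acc Q t.
Proof.
move=> n; apply: contrapT => h; apply: n; constructor => t qt.
by apply: contrapT => n; apply: h; exists t.
Qed.

(** Along a descending sequence the attempts are compatible and their lengths
are unbounded. *)
Lemma not_acc_branch : ~ Acc R 0 -> exists h, branch h.
Proof.
move=> n0.
have /choice [next nextP] : forall s, exists t,
    ~ Acc R s -> R t s /\ ~ Acc R t.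
  move=> s.
  have [a|/not_acc_pred [t]] := pselect (Acc R s); last by exists t.
  by exists 0.
pose f n := iter n next 0.
have fP n : R (f n.+1) (f n) /\ ~ Acc R (f n).
  suff na : ~ Acc R (f n) by have [] := nextP _ na.
  by elim: n => [//|n IH]; have [] := nextP _ IH.
have lf n : n <= len (f n).
  by elim: n => [//|n IH]; have [[_ [l _]] _] := fP n; lia.
(* The sequence [f k.+1] is long enough to have a place [k]. *)
pose h k := ent (f k.+1) k.
have fh n k : k < n -> ent (f n) k = h k.
  elim: n => [//|n IH]; rewrite ltnS leq_eqVlt => /orP[/eqP -> //|kn].
  have [[_ [_ e]] _] := fP n; rewrite e ?IH //.
  exact: leq_trans kn (lf n).
exists h => k0 k1 k2; pose n := (maxn k0 (maxn k1 k2)).+1.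
have [[+ _] _] := fP n; rewrite treeE.
have ln : n < len (f n.+1) := lf n.+1.
move=> /(_ k0 k1 k2); rewrite !fh //; first apply; rewrite /n in ln *; lia.
Qed.

Lemma branch_hier h : branch h ->
  let G n := [set x | 0 < hd (h (pr n x))] in
  hierarchy_below A R 0 G /\ seems_well_founded R 0 G.
Proof.
move=> bh G; split=> [c c0 i x|c i y c0 Gy].
  pose k0 := pr (pr c i) x.
  have cl k1 k2 := bh k0 k1 k2.
  have nk0 : node k0 = c by rewrite /node !hd_pr.
  have ik0 : idx k0 = i by rewrite /idx hd_pr tl_pr.
  have ak0 : arg k0 = x by rewrite /arg tl_pr.
  move: cl; rewrite /clauses nk0 ik0 ak0 => cl.
  rewrite /level /step /lower /G /= -/k0.
  case e : (hd i) cl => [|[|[|[|[|t]]]]] cl.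
  - by have [/(_ erefl)] := cl 0 0 c0.
  - have [_ [/(_ erefl erefl)]] := cl (pr (hd x) (hd (tl x))) 0 c0.
    by rewrite /node hd_pr.
  - by have [_ [_ [/(_ erefl erefl erefl)]]] :=
      cl (pr (pr c (hd (tl i))) x) (pr (pr c (tl (tl i))) x) c0.
  - have cm m := cl (pr (pr c (tl i)) (pr m x)) 0 c0.
    have {}cm m : (0 < hd (h (pr (pr c (tl i)) (pr m x))) -> 0 < hd (h k0)) /\
       (hd (h k0) = m.+1 -> 0 < hd (h (pr (pr c (tl i)) (pr m x)))).
      have [_ [_ [_ [/(_ erefl)]]]] := cm m.
      by rewrite /arg tl_pr hd_pr => /(_ erefl).
    split=> [|[m /(proj1 (cm m))]] //.
    by case e' : (hd (h k0)) => [//|m] _; exists m; apply: (proj2 (cm m)).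
  - by have [_ [_ [_ [_ [/(_ erefl erefl)]]]]] :=
      cl (pr (pr c (tl i)) (tl x)) 0 c0.
  - by have [_ [_ [_ [_ [_ [/(_ isT erefl)]]]]]] :=
      cl (pr (pr c (tl i)) (pr (hd (tl x)) (pr (hd x) (tl (tl x))))) 0 c0.
pose k0 := pr (pr c i) (pr y 0).
have cl y' := bh k0 (pr c i) (pr (pr c i) (pr y' 0)).
have {}cl y' : (y' = tl (h (pr c i)) -> G (pr c i) (pr y' 0)) /\
   (R y' (tl (h (pr c i))) -> ~ G (pr c i) (pr y' 0)).
  have := cl y'; rewrite /clauses /node /arg !(hd_pr, tl_pr).
  move=> /(_ c0) [_ [_ [_ [_ [_ [_]]]]]] /(_ Gy erefl erefl erefl).
  by [].
exists (tl (h (pr c i))); first by apply (proj1 (cl _)).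
by move=> y' /(proj2 (cl _)).
Qed.

Lemma acc_minimal (Y : nat -> Prop) y : Acc R y -> Y y ->
  exists2 w, Y w & forall y', R y' w -> ~ Y y'.
Proof.
elim=> {}y _ IH Yy.
have [[y' [y'y Yy']]|n] := pselect (exists y', R y' y /\ Y y').
  exact: IH Yy'.
by exists y => // y' y'y Yy'; apply: n; exists y'.
Qed.

(** If the tree were well-founded, then the true hierarchy along it, with
witnesses and minimal elements chosen, would be a branch. *)
Lemma acc_branch : Acc R 0 -> exists h, branch h.
Proof.
move=> a0.
(* Whatever lies below some [y] has positive length, hence lies below 0. *)
have acc y : Acc R y.
  constructor => t [Tt [lt _]]; apply: (Acc_inv a0).
  by split=> //; split=> //; rewrite {1}/len /hd /=; lia.
pose G := true_hier A R.
have trG c : truthful A R G c by exact: true_hier_truthful.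
have /choice [h hP] : forall k, exists v,
    [/\ 0 < hd v <-> G (hd k) (tl k),
     hd (idx k) = 3 -> G (hd k) (tl k) ->
       G (pr (node k) (tl (idx k))) (pr (hd v).-1 (arg k)) &
     forall y, G k (pr y 0) -> G k (pr (tl v) 0) /\
       forall y', R y' (tl v) -> ~ G k (pr y' 0)].
  move=> k.
  have [w wP] : exists w, forall y, G k (pr y 0) -> G k (pr w 0) /\
       forall y', R y' w -> ~ G k (pr y' 0).
    have [[y Gy]|n] := pselect (exists y, G k (pr y 0)).
      have [w Gw hw] := acc_minimal (Y := fun y => G k (pr y 0)) (acc y) Gy.
      by exists w.
    by exists 0 => y Gy; case: n; exists y.
  have [Gk|n] := pselect (G (hd k) (tl k)); last first.
    by exists (pr 0 w); rewrite hd_pr tl_pr; split.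
  have [m mP] : exists m, hd (idx k) = 3 ->
      G (pr (node k) (tl (idx k))) (pr m (arg k)).
    have [e3|n3] := pselect (hd (idx k) = 3); last by exists 0.
    have := trG (node k) (idx k) (arg k).
    rewrite /level /node /idx pr_hdtl -/(arg k) -/(idx k) -/(node k) /step e3.
    by move=> -[/(_ Gk) [m hm] _]; exists m.
  by exists (pr m.+1 w); rewrite hd_pr tl_pr; split; [split|move=> e3 _; exact: mP|].
have hE k : (0 < hd (h k)) = G (hd k) (tl k) :> Prop.
  by apply: propext; have [] := hP k.
have trk k : G (hd k) (tl k) <->
    step A (lower R G (node k)) (level G (node k)) (idx k) (arg k).
  have := trG (node k) (idx k) (arg k).
  by rewrite {1}/level /node /idx pr_hdtl.
exists h => k0 k1 k2 _.
have := trk k0; rewrite /step /lower /level => t0.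
rewrite !hE.
split; first by move=> e; rewrite e in t0; exact: t0.
split.
  move=> e ->; rewrite e in t0.
  by rewrite {1}/node !(hd_pr, tl_pr); exact: t0.
split; first by move=> e -> ->; rewrite e in t0; rewrite !(hd_pr, tl_pr); exact: t0.
split.
  move=> e k1E; move: t0; rewrite e k1E !(hd_pr, tl_pr) -k1E => t0; split.
    by move=> g; apply/t0; exists (hd (arg k1)).
  move=> h0; have [_ /(_ e) w _] := hP k0.
  by rewrite h0 /= in w; apply: w; rewrite -hE h0.
split; first by move=> e ->; rewrite e in t0; rewrite !(hd_pr, tl_pr); exact: t0.
split.
  move=> e ->; rewrite !(hd_pr, tl_pr).
  by case: (hd (idx k0)) e t0 => [|[|[|[|[|t]]]]] // _ t0; exact: t0.
move=> g k0E -> k2E.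
have [_ _ w] := hP (hd k0).
have {w} [w1 w2] : G (hd k0) (pr (tl (h (hd k0))) 0) /\
       forall y', R y' (tl (h (hd k0))) -> ~ G (hd k0) (pr y' 0).
  by apply: (w (hd (arg k0))); move: g; rewrite {1}k0E /arg k0E !(hd_pr, tl_pr).
rewrite k2E !(hd_pr, tl_pr) -k2E; split=> [->//|]; exact: w2.
Qed.

(** The tree asks for a hierarchy along its own order. Were it well-founded, the
hierarchy would exist and be a branch of it. *)
Lemma tree_not_acc : ~ Acc R 0.
Proof. by move=> a0; have [h /branch_not_acc] := acc_branch a0; apply. Qed.


End Tree.

(** A pseudo-hierarchy in the sense of Harrison and Spector: a definable
ill-founded order, and a hierarchy along it that does not notice this. *)
Lemma pseudo_hierarchy N A : is_structure N -> rdef N A -> exists R,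
  [/\ rdef N R, forall a b c, R a b -> R b c -> R a c, ~ Acc R 0 &
   exists2 G, hierarchy_below A R 0 G & seems_well_founded R 0 G].
Proof.
move=> strN dA; exists (tree_rel (tree A)); split.
- exact: rdef_tree_rel.
- by move=> a b c; exact: tree_rel_trans.
- exact: tree_not_acc.
- have [h /branch_hier [hG wG]] := not_acc_branch (@tree_not_acc A).
  by eexists; [exact: hG|].
Qed.

(** * Ordinals *)

Section Ordinals.
Context {d : Order.disp_t} {O : orderType d}.
Hypothesis wfO : well_order (fun a b : O => (a <= b)%O).

Lemma ord_least (Q : O -> Prop) a : Q a ->
  exists2 b, Q b & forall c, Q c -> (b <= c)%O.
Proof.
move=> Qa; have [|b [[Qb minb] _]] := wfO (A := fun x => `[< Q x >]).
  by exists a; apply/asboolP.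
exists b; first exact/asboolP.
by move=> c Qc; apply: minb; apply/asboolP.
Qed.

Lemma ord_ind (Q : O -> Prop) :
  (forall a, (forall b, (b < a)%O -> Q b) -> Q a) -> forall a, Q a.
Proof.
move=> IH a; apply: contrapT => nQa.
have [b nQb minb] := ord_least (Q := fun x => ~ Q x) nQa.
apply: nQb; apply: IH => c cb; apply: contrapT => /minb.
by rewrite leNgt cb.
Qed.

Lemma ord_succ (a b : O) : (a < b)%O -> exists2 c, is_succ a c & (c <= b)%O.
Proof.
move=> ab; have [c ac minc] := ord_least (Q := fun x => (a < x)%O) ab.
by exists c; [split|exact: minc].
Qed.

Lemma ord_cases (a : O) :
  is_zero a \/ (exists c, is_succ c a) \/ is_limit a.
Proof.
have [?|nz] := pselect (is_zero a); first by left.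
have [?|ns] := pselect (exists c, is_succ c a); first by right; left.
by right; right.
Qed.

Lemma succ_le (a b c : O) : is_succ a b -> (c < b)%O -> (c <= a)%O.
Proof.
move=> [_ h] cb; rewrite leNgt; apply/negP => /h.
by rewrite leNgt cb.
Qed.

Variables (canonic : set symbol -> (nat -> set nat) -> Prop).
Variables (N : set symbol) (lam : O) (M : O -> set symbol).
Hypothesis hM : hierarchy canonic N lam M.

Lemma hierarchy_mono (a b : O) : (a <= b)%O -> (b <= lam)%O -> M a `<=` M b.
Proof.
elim/ord_ind: b => b IH ab bl.
move: (ab); rewrite le_eqVlt => /orP[/eqP -> //|altb].
have [z|[[c cb]|lim]] := ord_cases b.
- by move: (z a); rewrite leNgt altb.
- have cltb : (c < b)%O by case: cb.
  have cl : (c < lam)%O by exact: lt_le_trans bl.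
  have [P _ ->] := hierarchy_succ hM cl cb.
  move=> s Ms; left; apply: IH Ms => //; last exact: ltW.
  exact: succ_le altb.
- by rewrite (hierarchy_limit hM bl lim) => s Ms; exists a.
Qed.

(** [N] is the structure at the least ordinal. *)
Lemma hierarchy_base a : (a <= lam)%O -> N `<=` M a.
Proof.
move=> al; have [z _ zm] := ord_least (Q := fun=> True) (a := a) I.
rewrite -(hierarchy_zero hM (a := z)); last by move=> b; exact: zm.
by apply: hierarchy_mono => //; exact: zm.
Qed.

Lemma hierarchy_str a : (a <= lam)%O -> is_structure (M a).
Proof.
move=> al s As; apply: (hierarchy_base al); exact: (hierarchy_structure hM).
Qed.

Lemma hierarchy_next a : (a < lam)%O -> exists b P,
  [/\ is_succ a b, (b <= lam)%O, canonic (M a) P & M b = expand (M a) P].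
Proof.
move=> al; have [b ab bl] := ord_succ al.
by have [P cP e] := hierarchy_succ hM al ab; exists b, P.
Qed.

(** A formula mentions finitely many symbols, so at a limit nothing new becomes
definable. *)
Lemma edef_limit b F : (b <= lam)%O -> is_limit b -> edef (M b) F ->
  exists2 c, (c < b)%O & edef (M c) F.
Proof.
move=> bl lim.
have lel c : (c < b)%O -> (c <= lam)%O.
  by move=> cb; apply: le_trans bl; exact: ltW.
have lec c c' F' : (c <= c')%O -> (c' < b)%O -> edef (M c) F' -> edef (M c') F'.
  by move=> cc c'b; apply: edef_mono; apply: hierarchy_mono => //; exact: lel.
have [c0 c0b] : exists c, (c < b)%O.
  apply: contrapT => n; apply: (proj1 lim) => c.
  by rewrite leNgt; apply/negP => cb; apply: n; exists c.
have st c (cb : (c < b)%O) := edef_closed (hierarchy_str (lel c cb)).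
apply: (@edef_ind (fun F => exists2 c, (c < b)%O & edef (M c) F)).
  split.
  - move=> F1 F2 e [c cb h]; exists c => //.
    by apply: edef_ext h => //; exact: hierarchy_str (lel c cb).
  - by move=> F1 [c cb h]; exists c => //; apply: fo_not => //; exact: st.
  - move=> F1 F2 [c cb h] [c' cb' h'].
    have [cc|/ltW cc] := leP c c'.
      by exists c' => //; apply: edef_and => //; exact: lec h.
    by exists c => //; apply: edef_and => //; exact: lec h'.
  - by move=> F1 [c cb h]; exists c => //; apply: fo_ex => //; exact: st.
  - by move=> i j; exists c0 => //; apply: fo_eq; exact: st.
move=> s; rewrite (hierarchy_limit hM bl lim) => -[c cb Ms].
exists c => //; apply: edef_symbol => //; exact: hierarchy_str (lel c cb).
Qed.

End Ordinals.

(** * Tarski hierarchies *)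

Section Tarski.
Variables (N : set symbol) (A : nat -> set nat) (R : nat -> nat -> Prop).
Hypotheses (strN : is_structure N) (cA : codes N A).
Let dA : rdef N A := proj1 cA.
Hypotheses (dR : rdef N R).
Hypothesis R_trans : forall a b c, R a b -> R b c -> R a c.

Notation H := (true_hier A R).
Notation below := (lower R).
Notation V := (below H).
Notation hier := (hierarchy_below A R).

Lemma lower_pr G b c i x : R c b -> below G b (pr c i) x = G (pr c i) x.
Proof.
by move=> cb; rewrite /lower hd_pr; apply: propext; split=> [[]|].
Qed.

Lemma lower_lower G b c : R c b -> below (below G b) c = below G c.
Proof.
move=> cb; apply: funext => n; apply: funext => x; apply: propext.
rewrite /lower; split=> [[nc [_ g]]|[nc g]] //; split => //; split => //.
exact: R_trans cb.
Qed.

Lemma hier_below b G : hier b G -> hier b (below G b).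
Proof.
move=> h c cb i x; rewrite lower_lower // /level lower_pr //.
have -> : (fun i => below G b (pr c i)) = level G c.
  by apply: funext => j; apply: funext => y; rewrite lower_pr.
exact: h.
Qed.

Lemma level_true c : Acc R c -> level H c = Tr A (V c).
Proof. by move=> ac; apply: truthful_level; exact: true_hier_truthful. Qed.

Lemma Def_below_col b c G X : hier b G -> R c b ->
  Def (expand N (below G c)) X -> exists i, col (level G c) i = X.
Proof.
by move=> h cb /(Def_col_Tr strN cA); rewrite (truthful_level (h _ cb)).
Qed.

Lemma rdef_col_level b c G : R c b -> rdef (expand N (below G b)) (col (level G c)).
Proof.
move=> cb; have strb := expand_str (below G b) strN.
have db := rdef_expand N (below G b).
apply: (@edef_ext _ (fun v => below G b (pr c (v 0)) (pr (v 1) 0))) => //.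
  by move=> v; rewrite lower_pr.
by edef.
Qed.

(** At an accessible [c] all hierarchies below [c] agree, so the columns of [P]
that are such hierarchies may be used without choosing among them. *)
Definition guess (P : nat -> set nat) (c : nat) : nat -> set nat :=
  fun n x => exists k, hier c (column P k) /\ below (column P k) c n x.

Lemma guessE M P c : is_structure M -> universal M P -> Acc R c ->
  rdef M (V c) -> guess P c = V c.
Proof.
move=> strM uP ac dV; apply: funext => n; apply: funext => x; apply: propext.
have hH := true_hier_hier A ac.
split=> [[k [h]]|g].
  by rewrite (hier_unique R_trans ac h hH).
have [k e] := column_of_rdef strM uP dV.
exists k; rewrite e; split; first exact: hier_below.
by case: (g) => nc _; split.
Qed.

(** The true hierarchy, as far as a universal predicate [P] knows it: find the
part below a point among the columns of [P], then the truth over it. *)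
Definition recover (P : nat -> set nat) : nat -> set nat :=
  fun n x => truth_via A P (guess P (hd n)) (tl n) x.

Lemma rdef_guess M P : is_structure M -> rdef M A -> rdef M R -> rdef M P ->
  edef M (fun v => guess P (v 0) (v 1) (v 2)).
Proof.
move=> strM dA' dR' dP.
rewrite /guess /hierarchy_below /truthful /level /column stepE /lower.
edef.
Qed.

Lemma rdef_recover M P : is_structure M -> rdef M A -> rdef M R -> rdef M P ->
  rdef M (recover P).
Proof.
move=> strM dA' dR' dP; have dg := rdef_guess strM dA' dR' dP.
by rewrite /recover /truth_via /column stepE; edef.
Qed.

Lemma recoverE M P n x : is_structure M -> N `<=` M -> universal M P ->
  Acc R (hd n) -> rdef M (V (hd n)) -> recover P n x <-> H n x.
Proof.
move=> strM sNM uP an dV.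
rewrite /recover (guessE strM uP an dV) (truth_viaE _ _ strM uP (edef_mono sNM dA) dV).
by rewrite -level_true // /level pr_hdtl.
Qed.

(** Passing to the next structure of a Tarski hierarchy reaches one level more:
if the parts below all [c] under [b] are definable, then a universal predicate
collects them. *)
Lemma rdef_below M M' P b : is_structure M -> N `<=` M -> universal M P ->
  is_structure M' -> N `<=` M' -> rdef M' P ->
  Acc R b -> (forall c, R c b -> rdef M (V c)) -> rdef M' (V b).
Proof.
move=> strM sNM uP strM' sNM' dP ab dV.
have dr := rdef_recover strM' (edef_mono sNM' dA) (edef_mono sNM' dR) dP.
have dR' := edef_mono sNM' dR.
have e n x : R (hd n) b -> recover P n x <-> H n x.
  by move=> nb; apply: (recoverE _ strM sNM uP (Acc_inv ab nb)); exact: dV.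
apply: (@edef_ext _ (fun v => R (hd (v 0)) b /\ recover P (v 0) (v 1))) => //.
  move=> v; rewrite /lower; split=> -[h1]; rewrite e //.
by edef.
Qed.

Section Along.
Context {d : Order.disp_t} {O : orderType d}.
Hypothesis wfO : well_order (fun a b : O => (a <= b)%O).
Variables (lam : O) (M : O -> set symbol).
Hypothesis hM : tarski_hierarchy N lam M.

Let strM a (al : (a <= lam)%O) := hierarchy_str wfO hM al.
Let sNM a (al : (a <= lam)%O) := hierarchy_base wfO hM al.

Lemma universal_col_level a b c G : R c b -> hier b G ->
  def_le (M a) (expand N (below G c)) -> universal (M a) (col (level G c)).
Proof.
move=> cb h le X /(Def_sub le) /(Def_below_col h cb) [i e].
by exists i.
Qed.

(** An inaccessible point has inaccessible points below it. By induction the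
enumeration at such a lower point is universal for an earlier structure, whose
canonic universal predicate is therefore definable from it. *)
Lemma nonacc_above a b G : (a <= lam)%O -> ~ Acc R b -> hier b G ->
  def_le (M a) (expand N (below G b)).
Proof.
elim/(ord_ind wfO): a b => a IH b al nb h.
have strb : is_structure (expand N (below G b)) by exact: expand_str.
have [z|[[c ca]|lim]] := ord_cases a.
- rewrite (hierarchy_zero hM z) => F; apply: edef_mono; exact: sub_expand.
- have clta : (c < a)%O by case: ca.
  have clam : (c < lam)%O by exact: lt_le_trans al.
  have [P [uP cP] ->] := hierarchy_succ hM clam ca.
  have strc := strM (ltW clam).
  apply: def_le_expand => //; first exact: IH (ltW clam) nb h.
  have [b' b'b nb'] := not_acc_pred nb.
  have le' := IH c clta b' (ltW clam) nb' (hier_down R_trans b'b h).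
  have /cP /definable_rel := universal_col_level b'b h le'.
  apply: def_le_expand => //; last exact: rdef_col_level.
  exact: IH (ltW clam) nb h.
- move=> F /(edef_limit wfO hM al lim) [c ca].
  by apply: IH => //; apply: ltW; exact: lt_le_trans al.
Qed.

(** Otherwise a level of [G] would be a universal predicate for [M a] definable
in [M a]. *)
Lemma hier_acc a b G : (a <= lam)%O -> hier b G -> rdef (M a) G -> Acc R b.
Proof.
move=> al h dG; apply: contrapT => nb.
have [c cb nc] := not_acc_pred nb.
have uU := universal_col_level cb h
  (nonacc_above al nc (hier_down R_trans cb h)).
apply: (universal_not_rdef (strM al) uU); have st := strM al.
by rewrite /col /level /=; edef.
Qed.

Lemma def_le_below a b P : (a <= lam)%O -> Acc R b -> canonic_universal (M a) P ->
  universal (M a) (col (V b)) -> def_le (expand (M a) P) (expand N (V b)).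
Proof.
move=> al ab [_ cP] uV; have st := strM al.
have strb : is_structure (expand N (V b)) by exact: expand_str.
have dV : rdef (expand N (V b)) (col (V b)).
  have dV := rdef_expand N (V b).
  by rewrite /col /=; edef.
have le : def_le (M a) (expand N (V b)) by exact: def_le_universal uV dV.
apply: def_le_expand => //.
have /cP /definable_rel := uV.
by apply: def_le_expand.
Qed.

Lemma lower_col b c : R c b -> forall i, col (V b) (pr c i) = col (level H c) i.
Proof.
by move=> cb i; apply: funext => x; rewrite /col /= lower_pr.
Qed.

(** The true hierarchy is never out of step with the Tarski hierarchy. If all
parts below points under [b] were definable in an earlier structure [M c], then
the part below [b] would be definable in the next one. Hence under [b] there is,
for each such [c], a point whose lower part is not definable in [M c]; inductively
it yields a universal predicate for [M c], and with it the canonic one. *)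
Lemma universal_below a b : (a <= lam)%O -> Acc R b -> ~ rdef (M a) (V b) ->
  universal (M a) (col (V b)).
Proof.
elim/(ord_ind wfO): a b => a IH b al ab nV X dX.
(* A level enumerates what is definable from its lower part. *)
suff [c cb] : exists2 c, R c b & Def (expand N (V c)) X.
  move=> /(Def_below_col (true_hier_hier A ab) cb) [i <-].
  by exists (pr c i); rewrite // lower_col.
have next c a' P : (c < a)%O -> is_succ c a' -> canonic_universal (M c) P ->
    M a' = expand (M c) P ->
    exists2 b', R b' b & def_le (M a') (expand N (V b')).
  move=> ca ca' cP Ma'.
  have cl : (c <= lam)%O by apply: ltW; exact: lt_le_trans al.
  have a'a : (a' <= a)%O by case: ca' => _; exact.
  have a'l : (a' <= lam)%O by exact: le_trans al.
  have [b' [b'b nV']] : exists b', R b' b /\ ~ rdef (M c) (V b').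
    apply: contrapT => n; apply: nV.
    apply: (edef_mono (hierarchy_mono wfO hM a'a al)).
    apply: (rdef_below (strM cl) (sNM cl) (proj1 cP)) => //.
    - exact: strM.
    - exact: sNM.
    - rewrite Ma'; exact: rdef_expand.
    - by move=> b' b'b; apply: contrapT => nV'; apply: n; exists b'.
  exists b' => //; rewrite Ma'.
  have ab' : Acc R b' by exact: Acc_inv b'b.
  by apply: def_le_below => //; exact: IH.
have [z|[[c ca]|lim]] := ord_cases a.
- have [c cb] : exists c, R c b.
    apply: contrapT => n; apply: nV.
    apply: (@edef_ext _ (fun=> False)); [exact: strM| |].
      by move=> v; split=> // -[h _]; apply: n; exists (hd (v 0)).
    exact: edef_const (strM al) _.
  exists c => //; move: dX; rewrite (hierarchy_zero hM z).
  by apply: Def_sub => F; apply: edef_mono; exact: sub_expand.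
- have clta : (c < a)%O by case: ca.
  have clam : (c < lam)%O by exact: lt_le_trans al.
  have [P cP e] := hierarchy_succ hM clam ca.
  have [b' b'b le] := next c a P clta ca cP e.
  by exists b' => //; exact: Def_sub le _ dX.
- move: dX => /DefE /(edef_limit wfO hM al lim) [c clta dX].
  have clam : (c < lam)%O by exact: lt_le_trans al.
  have [a' [P [ca' _ cP e]]] := hierarchy_next wfO hM clam.
  have [b' b'b le] := next c a' P clta ca' cP e.
  exists b' => //; apply/DefE; apply: le.
  by rewrite e; apply: edef_mono dX; exact: sub_expand.
Qed.

Hypothesis nonacc0 : ~ Acc R 0.
Variable G : nat -> set nat.
Hypothesis hG : hier 0 G.
Hypothesis wfG : seems_well_founded R 0 G.

(** What is definable from the part of the pseudo-hierarchy below [c] is enumerated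
at level [c], where it cannot reveal a descent. *)
Lemma overspill c (Z : set nat) y : R c 0 -> Def (expand N (below G c)) Z ->
  Z y -> exists2 w, Z w & forall y', R y' w -> ~ Z y'.
Proof.
move=> c0 /(Def_below_col hG c0) [i <-]; exact: wfG.
Qed.

Lemma exists_leaf : exists b, forall c, ~ R c b.
Proof.
have [c c0 nc] := not_acc_pred nonacc0.
have [b bc nb] := not_acc_pred nc.
have strc : is_structure (expand N (below G c)) by exact: expand_str.
have dR' : rdef (expand N (below G c)) R by apply: edef_mono dR; exact: sub_expand.
have [|w wc minw] := overspill (Z := [set x | R x c]) c0 _ bc.
  by apply/DefE => /=; edef.
exists w => e ew; apply: (minw e) => //=; exact: R_trans wc.
Qed.

(** The heart of the matter. Suppose that the true hierarchy is definable in
[M a] below every accessible point. All levels of the pseudo-hierarchy at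
inaccessible points are universal for [M a], so the canonic universal predicate
[P] of [M a] is definable from each of them, and hence enumerated at every
inaccessible level. Since the pseudo-hierarchy sees no descent, there is a
minimal level, under a fixed one, at which [P] is enumerated; that level is
accessible. So [P] is definable from a part of the true hierarchy, that is, in
[M a], against the diagonal argument. *)
Lemma undefinable_below a : (a < lam)%O -> exists2 b, Acc R b & ~ rdef (M a) (V b).
Proof.
move=> alam; apply: contrapT => n.
have {n} dV b : Acc R b -> rdef (M a) (V b).
  by move=> ab; apply: contrapT => nV; apply: n; exists b.
have [a' [P [aa' a'l cP e]]] := hierarchy_next wfO hM alam.
have st := strM (ltW alam).
have above b : ~ Acc R b -> hier b G -> rdef (expand N (below G b)) P.
  move=> nb hb; apply: (nonacc_above a'l nb hb); rewrite e; exact: rdef_expand.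
(* Levels enumerate sets of numbers, so [P] is packed into one set [Q]. *)
pose Q := [set z | P (hd z) (tl z)].
pose Z := [set x | exists i, forall y, G (pr x i) (pr y 0) <-> Q y].
have ZE x : ~ Acc R x -> R x 0 -> Z x.
  move=> nx x0; have hx := hier_down R_trans x0 hG.
  have strx := expand_str (below G x) strN.
  have dP := above x nx hx.
  have : Def (expand N (below G x)) Q by apply/DefE; rewrite /Q /=; edef.
  by move=> /(Def_below_col hG x0) [i hi]; exists i => y; rewrite -hi.
have [c c0 nc] := not_acc_pred nonacc0.
have [b bc nb] := not_acc_pred nc.
have hc := hier_down R_trans c0 hG.
have b0 := R_trans bc c0.
have [||w [wc Zw] minw] := overspill (Z := [set x | R x c /\ Z x]) (y := b) c0.
- have strc : is_structure (expand N (below G c)) by exact: expand_str.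
  have dR' : rdef (expand N (below G c)) R.
    by apply: edef_mono dR; exact: sub_expand.
  have dP := above c nc hc.
  have dG := rdef_expand N (below G c).
  apply/DefE; apply: (@edef_ext _ (fun v => R (v 0) c /\ exists i, forall y,
     below G c (pr (v 0) i) (pr y 0) <-> P (hd y) (tl y))) => //; last by edef.
  move=> v; split=> -[vc [i h]]; split=> //; exists i => y; move: (h y);
    by rewrite /Q /= lower_pr.
- by split; [|exact: ZE].
have w0 := R_trans wc c0.
have aw : Acc R w.
  apply: contrapT => nw; have [w' w'w nw'] := not_acc_pred nw.
  have w'c := R_trans w'w wc.
  apply: (minw w') => //; split => //; apply: ZE => //; exact: R_trans c0.
have hw := hier_down R_trans w0 hG.
have [i hi] := Zw.
have dQ : Def (M a) Q.
  have -> : Q = col (Tr A (V w)) i.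
    rewrite -(hier_unique R_trans aw hw (true_hier_hier A aw)).
    rewrite -(truthful_level (hG w0)); apply: funext => y; apply: propext.
    by rewrite -hi.
  apply: Def_Tr_col => //; last exact: dV.
  exact: edef_mono (sNM (ltW alam)) dA.
apply: (universal_not_rdef st (proj1 cP)).
have {}dQ : edef (M a) (fun v => Q (v 0)) by exact/DefE.
apply: (@edef_ext _ (fun v => Q (pr (v 0) (v 1)))) => //; last by edef.
by move=> v; rewrite /Q /= hd_pr tl_pr.
Qed.

Lemma undefinable_below_min a : (a < lam)%O -> exists b,
  [/\ Acc R b, ~ rdef (M a) (V b) & forall c, R c b -> rdef (M a) (V c)].
Proof.
move=> al; have [b ab nV] := undefinable_below al.
elim: ab nV => {}b ab IH nV.
have [[c [cb nc]]|n] := pselect (exists c, R c b /\ ~ rdef (M a) (V c)).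
  exact: IH nc.
exists b; split => //.
by move=> c cb; apply: contrapT => nc; apply: n; exists c.
Qed.

Lemma Def_below_min a b i : (a <= lam)%O -> Acc R b ->
  (forall c, R c b -> rdef (M a) (V c)) -> Def (M a) (col (V b) i).
Proof.
move=> al ab dV; have st := strM al.
have [ib|n] := pselect (R (hd i) b).
  have -> : col (V b) i = col (Tr A (V (hd i))) (tl i).
    have := lower_col ib (tl i); rewrite pr_hdtl => ->.
    by rewrite (level_true (Acc_inv ab ib)).
  by apply: Def_Tr_col => //; [exact: edef_mono (sNM al) dA|exact: dV].
have -> : col (V b) i = set0; last by apply/DefE; exact: edef_const.
by apply: funext => x; apply: propext; split=> // -[].
Qed.

(** Take a minimal accessible [b] with [V b] not definable in [M a]. The levels
below it enumerate sets definable in [M a], and together they enumerate all of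
them. *)
Lemma canonic_gives_proper a P : (a < lam)%O -> canonic_universal (M a) P ->
  exists2 F, proper_universal (M a) F & rdef (expand (M a) P) F.
Proof.
move=> alam [uP _]; have al := ltW alam; have st := strM al.
have ste := expand_str P st.
have [b [ab nV dV]] := undefinable_below_min alam.
exists (col (V b)).
  apply/seteqP; split; first exact: universal_below.
  by move=> _ [i _ <-]; exact: Def_below_min.
have : rdef (expand (M a) P) (V b).
  apply: (rdef_below st (sNM al) uP) => //; last exact: rdef_expand.
  by apply: subset_trans (sNM al) _; exact: sub_expand.
by move=> dVb; rewrite /col /=; edef.
Qed.

(** The levels of the true hierarchy whose lower part is definable in [M a]. *)
Definition enumeration a : nat -> set nat :=
  fun n => [set x | [/\ Acc R (hd n), rdef (M a) (V (hd n)) &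
                     Tr A (V (hd n)) (tl n) (pr x 0)]].

(** Unless [a] is zero, a set definable in [M a] is definable in a structure that
comes next after [M c] for some [c < a]. A minimal accessible point whose lower
part is not definable in [M c] has a lower part definable in the next structure,
and its level enumerates what is definable there. *)
Lemma enumeration_proper a : (a <= lam)%O ->
  proper_universal (M a) (enumeration a).
Proof.
move=> al; have st := strM al; have dA' := edef_mono (sNM al) dA.
have enumE b i : Acc R b -> rdef (M a) (V b) ->
    enumeration a (pr b i) = col (Tr A (V b)) i.
  move=> ab dV; apply: funext => x; apply: propext.
  by rewrite /enumeration /= hd_pr tl_pr; split=> [[]|].
apply/seteqP; split=> [X dX|_ [n _ <-]]; last first.
  have [[an dV]|nn] := pselect (Acc R (hd n) /\ rdef (M a) (V (hd n))).
    by rewrite -(pr_hdtl n) enumE //; exact: Def_Tr_col.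
  have -> : enumeration a n = set0; last by apply/DefE; exact: edef_const.
  by apply: funext => x; apply: propext; split=> // -[*]; apply: nn.
suff [b [ab dV]] : exists b, [/\ Acc R b, rdef (M a) (V b) &
    Def (expand N (V b)) X].
  move=> /(Def_col_Tr strN cA) [i <-].
  by exists (pr b i); rewrite ?enumE.
have next c a' P : (c < lam)%O -> (a' <= a)%O -> canonic_universal (M c) P ->
    M a' = expand (M c) P -> Def (M a') X ->
    exists b, [/\ Acc R b, rdef (M a) (V b) & Def (expand N (V b)) X].
  move=> clam a'a cP e dX'; have cl := ltW clam.
  have a'l : (a' <= lam)%O by exact: le_trans al.
  have [b [ab nV dV]] := undefinable_below_min clam.
  exists b; split => //.
    apply: (edef_mono (hierarchy_mono wfO hM a'a al)).
    apply: (rdef_below (strM cl) (sNM cl) (proj1 cP)) => //.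
    - exact: strM.
    - exact: sNM.
    - rewrite e; exact: rdef_expand.
  apply: Def_sub dX'; rewrite e; apply: def_le_below => //; exact: universal_below.
have [z|[[c ca]|lim]] := ord_cases a.
(* At zero, the level at a leaf is the truth predicate of [N] itself. *)
- have [b leaf] := exists_leaf.
  have ab : Acc R b by constructor=> c /leaf.
  exists b; split => //.
    apply: (@edef_ext _ (fun=> False)); [exact: st| |].
      by move=> v; split=> // -[/leaf].
    exact: edef_const st _.
  move: dX; rewrite (hierarchy_zero hM z).
  by apply: Def_sub => F; apply: edef_mono; exact: sub_expand.
- have clta : (c < a)%O by case: ca.
  have clam : (c < lam)%O by exact: lt_le_trans al.
  have [P cP e] := hierarchy_succ hM clam ca.
  exact: next clam (lexx a) cP e dX.
- move: dX => /DefE /(edef_limit wfO hM al lim) [c clta dX].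
  have clam : (c < lam)%O by exact: lt_le_trans al.
  have [a' [P [[ca' ha'] a'l cP e]]] := hierarchy_next wfO hM clam.
  apply: (next c a' P) => //; first exact: ha'.
  by apply/DefE; rewrite e; apply: edef_mono dX; exact: sub_expand.
Qed.

(** A proper universal predicate [P] has only definable columns. A hierarchy
below [b] found among them forces [b] to be accessible, so [P] tells the
accessible points that matter from the others, which an arbitrary universal
predicate need not do. *)
Lemma enumeration_canonic a : (a <= lam)%O ->
  canonic_proper_universal (M a) (enumeration a).
Proof.
move=> al; split; first exact: enumeration_proper.
move=> P pP; have st := strM al; have ste := expand_str P st.
have uP : universal (M a) P by rewrite /universal pP.
have dcol k : rdef (M a) (column P k).
  have : Def (M a) (P k) by rewrite pP; exists k.
  by move=> /DefE dk; rewrite /column; edef.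
have sNe : N `<=` expand (M a) P.
  by apply: subset_trans (sNM al) _; exact: sub_expand.
have dA' := edef_mono sNe dA; have dR' := edef_mono sNe dR.
have dP := rdef_expand (M a) P.
apply/definable_rel.
have dr := rdef_recover ste dA' dR' dP.
apply: (@edef_ext _ (fun v => (exists k, hier (hd (v 0)) (column P k)) /\
   recover P (v 0) (pr (v 1) 0)) _ ste); last first.
  apply: edef_and; last by edef.
  by rewrite /hierarchy_below /truthful /level /column stepE /lower; edef.
move=> v; rewrite /enumeration /=.
have recE : Acc R (hd (v 0)) -> rdef (M a) (V (hd (v 0))) ->
    recover P (v 0) (pr (v 1) 0) <-> Tr A (V (hd (v 0))) (tl (v 0)) (pr (v 1) 0).
  move=> an dV; rewrite (recoverE _ st (sNM al) uP an dV) -level_true //.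
  by rewrite /level pr_hdtl.
split=> [[[k hk] r]|[an dV t]].
  have an : Acc R (hd (v 0)) := hier_acc al hk (dcol k).
  have dV : rdef (M a) (V (hd (v 0))).
    rewrite -(hier_unique R_trans an hk (true_hier_hier A an)).
    have dk := dcol k; have dR'' := edef_mono (sNM al) dR.
    by rewrite /lower; edef.
  by split => //; apply/recE.
split; last exact/recE.
have [k e] := column_of_rdef st uP dV.
by exists k; rewrite e; apply: hier_below; exact: true_hier_hier.
Qed.

End Along.
End Tarski.

(** * The two hierarchies *)

(** Structures with the same definable sets can be exchanged under an added
predicate. *)
Lemma canonic_proper_transfer M M' P : is_structure M -> is_structure M' ->
  same_Def M M' -> canonic_proper_universal M P -> canonic_proper_universal M' P.
Proof.
move=> strM strM' e [pP cP]; split; first by rewrite /proper_universal -e.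
move=> P'; rewrite /proper_universal -e => /cP /definable_rel dP.
apply/definable_rel; move: dP; apply: def_le_expand => //.
- exact: expand_str.
- apply: def_le_unary => //; first exact: expand_str.
  rewrite e; apply: Def_sub => F; apply: edef_mono; exact: sub_expand.
- exact: rdef_expand.
Qed.

Theorem theorem2 (d : Order.disp_t) (O : orderType d)
  (wfO : well_order (fun a b : O => (a <= b)%O))
  (N : set symbol) (strN : is_structure N) (finN : L_finite N)
  (lam lamp : O) (M Mp : O -> set symbol)
  (hM : tarski_hierarchy N lam M)
  (hMp : proper_tarski_hierarchy N lamp Mp) :
  (lam < lamp)%O /\
  (forall a : O, (a <= lam)%O -> same_Def (Mp a) (M a)) /\
  ~ (exists P, canonic_universal (M lam) P) /\
  (exists P, canonic_proper_universal (M lam) P).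
Proof.
have [A cA] := finite_coded strN finN.
have [R [dR Rtr n0 [G hG wfG]]] := pseudo_hierarchy strN (proj1 cA).
have cproper a : (a <= lam)%O -> exists P, canonic_proper_universal (M a) P.
  move=> al; exists (enumeration A R M a).
  exact: (enumeration_canonic strN cA dR Rtr wfO hM n0 hG wfG).
have gives a P (alam : (a < lam)%O) (cP : canonic_universal (M a) P) :=
  canonic_gives_proper strN cA dR Rtr wfO hM n0 hG wfG alam cP.
have strM a (al : (a <= lam)%O) := hierarchy_str wfO hM al.
have strMp a (al : (a <= lamp)%O) := hierarchy_str wfO hMp al.
have same a : (a <= lam)%O -> (a <= lamp)%O -> same_Def (Mp a) (M a).
  elim/(ord_ind wfO): a => a IH al alp.
  have [sM sMp] := (strM a al, strMp a alp).
  have [z|[[c ca]|lim]] := ord_cases a.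
  - by rewrite /same_Def (hierarchy_zero hM z) (hierarchy_zero hMp z).
  - have clta : (c < a)%O by case: ca.
    have clam : (c < lam)%O by exact: lt_le_trans al.
    have clamp : (c < lamp)%O by exact: lt_le_trans alp.
    have e := IH c clta (ltW clam) (ltW clamp).
    have [P cP eM] := hierarchy_succ hM clam ca.
    have [P' cP' eMp] := hierarchy_succ hMp clamp ca.
    have sc := strM c (ltW clam); have scp := strMp c (ltW clamp).
    have [pP' canP'] := canonic_proper_transfer scp sc e cP'.
    have [F pF dF] := gives c P clam cP.
    rewrite /same_Def eM eMp; apply/seteqP; split; apply: Def_sub.
    + apply: def_le_expand => //; first exact: expand_str.
        apply: def_le_unary => //; first exact: expand_str.
        rewrite e; apply: Def_sub => F'; apply: edef_mono; exact: sub_expand.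
      have /canP' /definable_rel := pF.
      apply: def_le_expand => //; first exact: expand_str.
      by move=> F'; apply: edef_mono; exact: sub_expand.
    + have le : def_le (M c) (expand (Mp c) P').
        apply: def_le_unary => //; first exact: expand_str.
        rewrite -e; apply: Def_sub => F'; apply: edef_mono; exact: sub_expand.
      apply: def_le_expand => //; first exact: expand_str.
      have uP' : universal (M c) P' by rewrite /universal pP'.
      have := proj2 cP _ uP' => /definable_rel.
      apply: def_le_expand => //; first exact: expand_str.
      exact: rdef_expand.
  - apply/seteqP; split=> X /DefE dX.
      have [c ca /DefE] := edef_limit wfO hMp alp lim dX.
      have cl := lt_le_trans ca al; have clp := lt_le_trans ca alp.
      rewrite (IH c ca (ltW cl) (ltW clp)); apply: Def_sub => F.
      by apply: edef_mono; apply: (hierarchy_mono wfO hM) => //; exact: ltW.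
    have [c ca /DefE] := edef_limit wfO hM al lim dX.
    have cl := lt_le_trans ca al; have clp := lt_le_trans ca alp.
    rewrite -(IH c ca (ltW cl) (ltW clp)); apply: Def_sub => F.
    by apply: edef_mono; apply: (hierarchy_mono wfO hMp) => //; exact: ltW.
have lt : (lam < lamp)%O.
  rewrite ltNge; apply/negP => le; apply: (hierarchy_max hMp).
  have [P cP] := cproper lamp le; exists P.
  apply: canonic_proper_transfer cP; [exact: strM|exact: strMp|].
  by rewrite /same_Def same.
split=> //; split; last by split; [exact: (hierarchy_max hM)|exact: cproper].
by move=> a al; apply: same => //; exact: le_trans al (ltW lt).
Qed.
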